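(* Let $V$ be a countable vertex set and let $(c_t)_{t\in\mathbb{N}}$ be a deterministic sequence of symmetric conductances on $V$ that is non-decreasing in $t$ with limit $c_\infty$ (i.e. $c_t(u,v)\uparrow c_\infty(u,v)$ for all $u,v$), where $\pi_\infty(v)=\sum_z c_\infty(v,z)<\infty$ for every $v\in V$. Let $(X_t)_{t\ge0}$ be the random walk in the changing environment $(c_t)_{t\ge0}$, started at an arbitrary vertex. Suppose the (time-homogeneous) random walk on $G_0=(V,c_0)$ is irreducible and transient. Then $(X_t)_{t\ge0}$ is transient: almost surely every vertex is visited only finitely often. Moreover, for every $x\in V$ the expected number of visits to $x$ is finite and $$\sum_{t=0}^\infty \mathbb{P}(X_t=x)\le 2\,\pi_\infty(x)\,\mathcal{R}_{\mathrm{eff}}^{G_0}(x\leftrightarrow\infty).$$ Furthermore, for every $x\in V$ the escape probability is strictly positive: $$\mathbb{P}(X_t\ne x\text{ for all }t>0\mid X_0=x)>0.$$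
   Context: A network $(V,c)$ is a countable vertex set $V$ with symmetric conductances $c:V\times V\to[0,\infty)$. The total conductance of a vertex is $\pi(y)=\sum_z c(y,z)$, assumed finite at every vertex; vertices may have infinitely many neighbors. The random walk on $(V,c)$ at $y$ jumps to $z$ with probability $c(y,z)/\pi(y)$. The random walk in the changing environment $(c_t)_{t\ge0}$ is the time-inhomogeneous Markov chain with $\mathbb{P}(X_{t+1}=z\mid X_t=y)=c_t(y,z)/\pi_t(y)$, where $\pi_t(y)=\sum_z c_t(y,z)$. Effective resistance in a network $G=(V,c)$: for disjoint sets $A,B\subseteq V$, $\mathcal{R}_{\mathrm{eff}}^G(A\leftrightarrow B)^{-1}=\inf\{\tfrac12\sum_{u,v}c(u,v)(f(u)-f(v))^2: f:V\to\mathbb{R},\ f|_A=1,\ f|_B=0\}$, and $\mathcal{R}_{\mathrm{eff}}^G(x\leftrightarrow\infty)=\lim_{B\uparrow V}\mathcal{R}_{\mathrm{eff}}^G(\{x\}\leftrightarrow B^c)$, the limit being over finite sets $B\ni x$ increasing to exhaust $V$. *)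

(* Defs.v *)
From HB Require Import structures.
From mathcomp Require Import all_boot all_order all_algebra finmap.
From mathcomp Require Import all_classical all_reals all_analysis.
From mathcomp Require Import showcase.summability.
Set Implicit Arguments.
Unset Strict Implicit.
Unset Printing Implicit Defensive.
Import Order.TTheory GRing.Theory Num.Theory.
Import numFieldNormedType.Exports.
Local Open Scope classical_set_scope.
Local Open Scope ring_scope.
Local Open Scope ereal_scope.

Section Network.
Context {R : realType} {V : countType}.
Implicit Types c : V -> V -> R.

Definition conductances c : Prop :=
  (forall u v, c u v = c v u) /\ (forall u v, (0 <= c u v)%R).

Definition total_cond c (y : V) : \bar R := \esum_(z in [set: V]) (c y z)%:E.

(* [fine] loses nothing here: total conductances are assumed finite. *)
Definition jump c (y z : V) : R := (c y z / fine (total_cond c y))%R.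

Fixpoint jump_n c (n : nat) (y z : V) : \bar R :=
  if n is m.+1 then \esum_(w in [set: V]) ((jump c y w)%:E * jump_n c m w z)
  else if y == z then 1 else 0.

Definition irreducible_walk c : Prop :=
  forall y z, exists n, 0 < jump_n c n y z.

(* Half of the sum over ordered pairs; a diagonal term c u u contributes 0. *)
Definition energy c (f : V -> R) : \bar R :=
  (2^-1)%:E *
  \esum_(e in [set: V * V]) (c e.1 e.2 * (f e.1 - f e.2) ^+ 2)%:E.

(* The inverse on \bar R satisfies 0^-1 = +oo and +oo^-1 = 0. *)
Definition eff_res c (A B : set V) : \bar R :=
  (ereal_inf [set energy c f | f in
     [set f : V -> R | (forall v, A v -> f v = 1%R) /\
                       (forall v, B v -> f v = 0%R)]])^-1.

(* [totally] is the filter of tails of the finite subsets of V ordered by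
   inclusion, so that eventually x belongs to B. *)
Definition eff_res_infty c (x : V) : \bar R :=
  lim ((fun B : {fset V} => eff_res c [set x] (~` [set` B])) @ totally).

End Network.

Section Walk.
Context {R : realType} {V : countType} {d : measure_display}
  {Omega : measurableType d}.
Implicit Types (P : probability Omega R) (X : nat -> Omega -> V).

(* In [walk_step] the one-step conditional probabilities given the whole past
   are multiplied out, which avoids conditioning on null events. *)
Record random_walk (c : nat -> V -> V -> R) (o : V) P X : Prop := {
  walk_measurable : forall t (A : set V), measurable (X t @^-1` A) ;
  walk_start : P (X 0%N @^-1` [set o]) = 1 ;
  walk_step : forall t (h : nat -> V),
    P [set w | forall i, (i <= t.+1)%N -> X i w = h i] =
    P [set w | forall i, (i <= t)%N -> X i w = h i]
      * (jump (c t) (h t) (h t.+1))%:E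
}.

Definition transient P X : Prop :=
  {ae P, forall w, forall v, finite_set [set t | X t w = v]}.

Definition expected_visits P X (x : V) : \bar R :=
  \int[P]_w (counting [set t | X t w = x] : \bar R).

End Walk.

(* Main.v *)
(**
Write mu_t for the law of the walk at time t and f_t = mu_t / pi_t.  With
A_t(f,g) = sum pi_t f g and B_t(f,g) = sum c_t f g one has
A_(t+1)(f_(t+1), g) = B_t(f_t, g), and A_t(h,h) - B_t(h,h) is the Dirichlet energy
E_t(h), which is non-decreasing in t.  Put F_k = f_k + ... + f_(N-1).  Expanding
E_k(f_k + F_(k+1)) and using E_k <= E_(k+1) gives, by downward induction on k,
E_k(F_k) <= 2 A_k(f_k, F_k).  For a walk started at x this reads
E_0(F_0) <= 2 F_0(x), while truncating F_0 to finite sets gives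
F_0(x)^2 <= R_eff(x) E_0(F_0); hence F_0(x) <= 2 R_eff(x), which bounds the
expected number of visits to x.  The same bound holds at every starting time, so the
maximum principle extends it to every starting vertex.

Finiteness of R_eff(x) comes from the Green function of the walk on G_0: a transient
walk has a positive escape probability, hence by renewal a summable return
probability, and the partial sums of its f_t are near-unit flows of bounded energy.

For the escape probability, let the walk follow c_0 up to time T and c_t afterwards.
Its law at time T is a source of a flow to infinity of energy
sum_(s >= 2T) p_s(x,x) / pi_0(x), which is small, so by Cauchy-Schwarz the expected
number of visits to x after T is small, uniformly in the later environment.  It is
then smaller than the probability that the walk on G_0 avoids x during [1,T], so some
vertex y can be reached at time T along a path of G_0 avoiding x, from which the
changing walk has a positive chance never to hit x; that path has positive
probability in the changing environment as well.
*)
Require Import Defs.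
From mathcomp Require Import all_boot all_order all_algebra finmap.
From mathcomp Require Import all_classical all_reals all_analysis.
From mathcomp Require Import showcase.summability.
From mathcomp Require Import ring lra.
Import Order.TTheory GRing.Theory Num.Theory.
Import numFieldNormedType.Exports.
Local Open Scope classical_set_scope.
Local Open Scope ring_scope.
Local Open Scope ereal_scope.

Set Implicit Arguments.
Unset Strict Implicit.
Unset Printing Implicit Defensive.

Local Notation nneg f := (forall v, (0 <= f v)%R).

(** * Sums over arbitrary index types *)

Section esum_complements.
Context {R : realType}.
Implicit Types T : choiceType.

Lemma esumZl T (r : R) (a : T -> \bar R) : (0 <= r)%R -> (forall v, 0 <= a v) ->
  \esum_(v in [set: T]) (r%:E * a v) = r%:E * \esum_(v in [set: T]) a v.
Proof.
move=> r0 a0; rewrite /esum -ereal_supZl//; last first.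
  apply/set0P; exists (\sum_(x \in set0) a x).
  by exists set0 => //; exact: fsets_set0.
rewrite image_comp; congr ereal_sup; apply: eq_imagel => A _ /=.
by rewrite ge0_mule_fsumr.
Qed.

Lemma esum_ge_term T (a : T -> \bar R) x : (forall v, 0 <= a v) ->
  a x <= \esum_(v in [set: T]) a v.
Proof.
move=> a0; apply: esum_ge; exists [set x]; last by rewrite fsbig_set1.
by split=> //; exact: finite_set1.
Qed.

Lemma esum_pred1 T (a : T -> \bar R) x : (forall v, v != x -> a v = 0) -> 0 <= a x ->
  \esum_(v in [set: T]) a v = a x.
Proof.
move=> a0 ax; rewrite -(esum_set1 ax) [RHS]esum_mkcond; apply: eq_esum => v _.
by case: ifPn => //; rewrite notin_setE => /eqP /a0.
Qed.

Lemma esum_pair T1 T2 (a : T1 -> T2 -> \bar R) : (forall v w, 0 <= a v w) ->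
  \esum_(v in [set: T1]) \esum_(w in [set: T2]) a v w =
  \esum_(e in [set: T1 * T2]) a e.1 e.2.
Proof.
move=> a0; rewrite (@esum_esum _ _ _ _ (fun=> setT))//.
by congr esum; apply/seteqP; split.
Qed.

Lemma esum_swap T1 T2 (a : T1 -> T2 -> \bar R) : (forall v w, 0 <= a v w) ->
  \esum_(v in [set: T1]) \esum_(w in [set: T2]) a v w =
  \esum_(w in [set: T2]) \esum_(v in [set: T1]) a v w.
Proof.
move=> a0; rewrite !esum_pair//.
rewrite (reindex_esum [set: T2 * T1] _ (fun e => (e.2, e.1)))//; split => //=.
  by move=> [? ?] [? ?] /= _ _ [-> ->].
by move=> [v w] _; exists (w, v).
Qed.

Lemma esum_gt0 T (a : T -> \bar R) : (forall v, 0 <= a v) ->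
  0 < \esum_(v in [set: T]) a v -> exists v, 0 < a v.
Proof.
move=> a0; apply: contraPP => /forallNP h; apply/negP; rewrite -leNgt esum1// => v _.
by apply/eqP; rewrite eq_le a0 andbT leNgt; exact/negP.
Qed.

Lemma esum_approx T (a : T -> \bar R) (e : R) : (forall v, 0 <= a v) ->
    \esum_(v in [set: T]) a v < +oo -> (0 < e)%R ->
  exists B : {fset T}, \esum_(v in [set: T]) a v <=
    \esum_(v in [set: T]) (if v \in B then a v else 0) + e%:E.
Proof.
move=> a0 afin e0.
have afn : \esum_(v in [set: T]) a v \is a fin_num.
  by rewrite ge0_fin_numE// esum_ge0.
have /ereal_sup_gt[_ [A [finA _] <-] lt] :
    \esum_(v in [set: T]) a v - e%:E < \esum_(v in [set: T]) a v.
  by rewrite lteBlDr// lteDl.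
exists (fset_set A); move: lt; rewrite lteBlDr// => /ltW/le_trans; apply.
rewrite leeD2r// -esum_fset// esum_mkcond; apply: le_esum => v _.
by rewrite in_fset_set.
Qed.

End esum_complements.

(** * Bilinear forms of a network *)

Section forms.
Context {R : realType} {V : countType}.
Implicit Types (c : V -> V -> R) (w f g h : V -> R).

Definition network c : Prop :=
  conductances c /\ forall v, total_cond c v < +oo.

Definition wt c (v : V) : R := fine (total_cond c v).

(** With [w] the total conductance this is the form A of the overview; [bform] is B. Both are used
    on nonnegative functions only, where [\esum] is the true sum. *)
Definition mform w f g : \bar R := \esum_(v in [set: V]) (w v * f v * g v)%:E.

Definition bform c f g : \bar R :=
  \esum_(e in [set: V * V]) (c e.1 e.2 * f e.1 * g e.2)%:E.

Lemma total_cond_ge0 c v : network c -> 0 <= total_cond c v.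
Proof. by move=> [[_ c0] _]; apply: esum_ge0 => z _; rewrite lee_fin. Qed.

Lemma wtE c v : network c -> (wt c v)%:E = total_cond c v.
Proof.
move=> nc; rewrite /wt fineK// ge0_fin_numE ?total_cond_ge0//.
by case: nc => _; exact.
Qed.

Lemma wt_ge0 c v : network c -> (0 <= wt c v)%R.
Proof. by move=> nc; rewrite fine_ge0// total_cond_ge0. Qed.

Lemma mform_ge0 w f g : nneg w -> nneg f -> nneg g -> 0 <= mform w f g.
Proof. by move=> w0 f0 g0; apply: esum_ge0 => v _; rewrite lee_fin !mulr_ge0. Qed.

Lemma bform_ge0 c f g : network c -> nneg f -> nneg g -> 0 <= bform c f g.
Proof.
by move=> [[_ c0] _] f0 g0; apply: esum_ge0 => v _; rewrite lee_fin !mulr_ge0.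
Qed.

Lemma energy_ge0 c f : network c -> 0 <= energy c f.
Proof.
move=> [[_ c0] _]; rewrite /energy mule_ge0 ?lee_fin ?invr_ge0//.
by apply: esum_ge0 => e _; rewrite lee_fin mulr_ge0// sqr_ge0.
Qed.

Lemma mformC w f g : mform w f g = mform w g f.
Proof. by apply: eq_esum => v _; rewrite mulrAC. Qed.

Lemma bformE c f g : network c -> nneg f -> nneg g ->
  bform c f g = \esum_(v in [set: V]) \esum_(u in [set: V]) (c u v * f u * g v)%:E.
Proof.
move=> [[_ c0] _] f0 g0; rewrite esum_swap ?esum_pair// => u v;
  by rewrite lee_fin !mulr_ge0.
Qed.

Lemma bformC c f g : network c -> nneg f -> nneg g -> bform c f g = bform c g f.
Proof.
move=> nc f0 g0; rewrite bformE//; case: nc => -[cC c0] _.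
rewrite esum_pair/=; last by move=> u v; rewrite lee_fin !mulr_ge0.
by apply: eq_esum => -[u v] _ /=; rewrite cC mulrAC.
Qed.

Lemma esum_edge1 c h : network c -> nneg h ->
  \esum_(e in [set: V * V]) (c e.1 e.2 * h e.1)%:E =
  \esum_(v in [set: V]) (wt c v * h v)%:E.
Proof.
move=> nc h0; have [[_ c0] _] := nc.
rewrite -(@esum_pair _ _ _ (fun u v => (c u v * h u)%:E)); last first.
  by move=> u v; rewrite lee_fin mulr_ge0.
apply: eq_esum => u _; rewrite mulrC EFinM wtE// -esumZl//; last by move=> v; rewrite lee_fin.
by apply: eq_esum => v _; rewrite mulrC EFinM.
Qed.

Lemma esum_edge2 c h : network c -> nneg h ->
  \esum_(e in [set: V * V]) (c e.1 e.2 * h e.2)%:E =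
  \esum_(v in [set: V]) (wt c v * h v)%:E.
Proof.
move=> nc h0; have [[cC c0] _] := nc; rewrite -esum_edge1//.
rewrite (reindex_esum [set: V * V] _ (fun e => (e.2, e.1))); last first.
  split => //=; first by move=> [? ?] [? ?] /= _ _ [-> ->].
  by move=> [v w] _; exists (w, v).
by apply: eq_esum => -[u v] _ /=; rewrite cC.
Qed.

(** Expanding the square, the two diagonal halves collapse to A and the cross term is B. The
    additive form E + B = A avoids subtracting infinite values. *)
Lemma energy_bform c h : network c -> nneg h ->
  energy c h + bform c h h = mform (wt c) h h.
Proof.
move=> nc h0; have [[cC c0] _] := nc.
have hh0 : nneg (fun v => 2^-1 * (h v * h v))%R.
  by move=> v; rewrite !mulr_ge0.
transitivity (\esum_(e in [set: V * V]) (c e.1 e.2 * (2^-1 * (h e.1 * h e.1)))%:E +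
              \esum_(e in [set: V * V]) (c e.1 e.2 * (2^-1 * (h e.2 * h e.2)))%:E).
  rewrite /energy -esumZl//; last by move=> e; rewrite lee_fin mulr_ge0 ?sqr_ge0.
  rewrite -!esumD//; try by move=> e _; rewrite lee_fin ?mulr_ge0 ?sqr_ge0.
    by apply: eq_esum => e _; rewrite -EFinM -!EFinD; congr EFin; field.
  by move=> e _; rewrite mule_ge0// lee_fin mulr_ge0 ?sqr_ge0.
rewrite (esum_edge1 nc hh0) (esum_edge2 nc hh0) -esumD//; last 2 first.
- by move=> v _; rewrite lee_fin mulr_ge0 ?wt_ge0.
- by move=> v _; rewrite lee_fin mulr_ge0 ?wt_ge0.
by apply: eq_esum => v _; rewrite -EFinD; congr EFin; field.
Qed.

Lemma mformDr w f g h : nneg w -> nneg f -> nneg g -> nneg h ->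
  mform w f (g \+ h)%R = mform w f g + mform w f h.
Proof.
move=> w0 f0 g0 h0; rewrite /mform -esumD//;
  try by move=> v _; rewrite lee_fin !mulr_ge0.
by apply: eq_esum => v _; rewrite /= mulrDr EFinD.
Qed.

Lemma bformDr c f g h : network c -> nneg f -> nneg g -> nneg h ->
  bform c f (g \+ h)%R = bform c f g + bform c f h.
Proof.
move=> [[_ c0] _] f0 g0 h0; rewrite /bform -esumD//;
  try by move=> v _; rewrite lee_fin !mulr_ge0.
by apply: eq_esum => v _; rewrite /= mulrDr EFinD.
Qed.

(** Cauchy-Schwarz with a free weight [l] in place of square roots, which stays valid for infinite
    values. *)
Lemma mform_cauchy w f g (l : R) : nneg w -> nneg f -> nneg g -> (0 <= l)%R ->
  (2 * l)%:E * mform w f g <= mform w f f + (l ^+ 2)%:E * mform w g g.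
Proof.
move=> w0 f0 g0 l0; rewrite -!esumZl//; try by [rewrite mulr_ge0|rewrite sqr_ge0|
  move=> v; rewrite lee_fin !mulr_ge0].
rewrite -esumD//; try by move=> v _; rewrite -?EFinM lee_fin !mulr_ge0// sqr_ge0.
apply: le_esum => v _; rewrite -!EFinM -EFinD lee_fin.
have := mulr_ge0 (w0 v) (sqr_ge0 (f v - l * g v)%R); nra.
Qed.

(** The same for the energy, whose bilinear form is A - B, with B moved to the right. *)
Lemma energy_cauchy c f g (l : R) : network c -> nneg f -> nneg g -> (0 <= l)%R ->
  (2 * l)%:E * mform (wt c) f g <=
  energy c f + (l ^+ 2)%:E * energy c g + (2 * l)%:E * bform c f g.
Proof.
move=> nc f0 g0 l0; have [[_ c0] _] := nc.
have fg0 : nneg (fun v => l * (f v * g v))%R by move=> v; rewrite !mulr_ge0.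
(* The vertex sum is spread over the edges, half at each endpoint, so that the inequality can be
   checked edge by edge. *)
have -> : (2 * l)%:E * mform (wt c) f g =
   \esum_(e in [set: V * V]) (c e.1 e.2 * (l * (f e.1 * g e.1)))%:E +
   \esum_(e in [set: V * V]) (c e.1 e.2 * (l * (f e.2 * g e.2)))%:E.
  rewrite (esum_edge1 nc fg0) (esum_edge2 nc fg0) -esumD//;
    try by move=> v _; rewrite lee_fin mulr_ge0// wt_ge0.
  rewrite -esumZl//; [|by rewrite mulr_ge0|by move=> v; rewrite lee_fin !mulr_ge0// wt_ge0].
  by apply: eq_esum => v _; rewrite -EFinM -EFinD; congr EFin; ring.
have -> : (2 * l)%:E * bform c f g = l%:E * bform c f g + l%:E * bform c g f.
  rewrite (bformC nc g0 f0) -ge0_muleDl ?lee_fin// -EFinD.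
  by congr (_%:E * _); ring.
have E0 h e : (0 <= c e.1 e.2 * (h e.1 - h e.2) ^+ 2)%R by rewrite mulr_ge0 ?sqr_ge0.
rewrite /energy -!esumZl//; try by [rewrite mulr_ge0|rewrite sqr_ge0|
  move=> v; rewrite -?EFinM lee_fin !mulr_ge0// sqr_ge0].
rewrite -!esumD//; try by move=> v _; rewrite -?EFinM lee_fin !mulr_ge0// sqr_ge0.
  apply: le_esum => -[u v] _ /=; rewrite -!EFinM -!EFinD lee_fin.
  have := mulr_ge0 (c0 u v) (sqr_ge0 ((f u - f v) - l * (g u - g v))%R); nra.
all: move=> e *; rewrite -?EFinM -?EFinD lee_fin.
all: by do ![exact: sqr_ge0|exact: E0|exact: c0|apply: addr_ge0|apply: mulr_ge0]; rewrite ?invr_ge0.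

Qed.

Lemma energy_abs c f : network c -> energy c (fun v => `|f v|)%R <= energy c f.
Proof.
move=> [[_ c0] _]; rewrite /energy lee_wpmul2l ?lee_fin ?invr_ge0//.
apply: le_esum => e _; rewrite lee_fin ler_wpM2l//.
rewrite -[leLHS]real_normK ?num_real// -[leRHS]real_normK ?num_real//.
by rewrite ler_pXn2r ?nnegrE// ler_dist_dist.
Qed.

Lemma energy_le c c' f : network c -> network c' ->
  (forall u v, c u v <= c' u v)%R -> energy c f <= energy c' f.
Proof.
move=> nc nc' cc'; rewrite /energy lee_wpmul2l ?lee_fin ?invr_ge0//.
by apply: le_esum => e _; rewrite lee_fin ler_wpM2r// sqr_ge0.
Qed.

Lemma wt_le c c' v : network c -> network c' ->
  (forall u v, c u v <= c' u v)%R -> (wt c v <= wt c' v)%R.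
Proof.
move=> nc nc' cc'; rewrite -lee_fin !wtE//.
by apply: le_esum => e _; rewrite lee_fin.
Qed.

End forms.

(** * Laws and densities of the walk *)

Section chain.
Context {R : realType} {V : countType}.
Implicit Types (c : nat -> V -> V -> R).

(** Positive total conductances make the jump kernels stochastic: at total conductance 0, division
    by 0 would make every jump 0. *)
Record environment c : Prop := {
  env_network : forall t, network (c t) ;
  env_le : forall s t, (s <= t)%N -> forall u v, (c s u v <= c t u v)%R ;
  env_wt_gt0 : forall t v, (0 < wt (c t) v)%R }.

Lemma environment_shift c k : environment c -> environment (fun t => c (k + t)%N).
Proof.
case=> cn cl cw; split=> // s t st u v; apply: cl.
by rewrite leq_add2l.
Qed.

Lemma environment_cst c : environment c -> environment (fun=> c 0%N).
Proof. by case=> cn cl cw; split. Qed.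

Lemma jump_ge0 (c : V -> V -> R) y z : network c -> (0 <= jump c y z)%R.
Proof.
by move=> nc; rewrite /jump divr_ge0//; [case: nc => -[]|exact: wt_ge0].
Qed.

Lemma jump_sum (c : V -> V -> R) y : network c -> (0 < wt c y)%R ->
  \esum_(z in [set: V]) (jump c y z)%:E = 1.
Proof.
move=> nc w0; have := wtE y nc; have [[_ c0] _] := nc.
move=> wE; transitivity ((wt c y)^-1%:E * total_cond c y).
  rewrite -esumZl ?invr_ge0 ?wt_ge0//; last by move=> v; rewrite lee_fin.
  by apply: eq_esum => z _; rewrite -EFinM mulrC.
by rewrite -wE -EFinM mulVf// gt_eqF.
Qed.

(** Unlike [jump_n], this carries the absolute time [s] of the first jump, since the environment
    changes. *)
Fixpoint pr c (s n : nat) (y z : V) : \bar R :=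
  if n is m.+1 then \esum_(w in [set: V]) ((jump (c s) y w)%:E * pr c s.+1 m w z)
  else if y == z then 1 else 0.

Variables (c : nat -> V -> V -> R) (ce : environment c).

Let cn t : network (c t) := env_network ce t.
Let j0 t y z : 0 <= (jump (c t) y z)%:E.
Proof. by rewrite lee_fin jump_ge0. Qed.

Lemma pr_ge0 s n y z : 0 <= pr c s n y z.
Proof.
elim: n s y => [|n IH] s y /=; first by case: ifP.
by apply: esum_ge0 => w _; rewrite mule_ge0.
Qed.

Lemma pr_sum s n y : \esum_(z in [set: V]) pr c s n y z = 1.
Proof.
elim: n s y => [|n IH] s y /=.
  rewrite (@esum_pred1 _ _ _ y) ?eqxx// => v; first by rewrite eq_sym => /negPf ->.
rewrite esum_swap; last by move=> ? ?; rewrite mule_ge0// pr_ge0.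
rewrite -[RHS](jump_sum (cn s) (env_wt_gt0 ce s y)); apply: eq_esum => w _.
by rewrite esumZl ?IH ?mule1 ?jump_ge0// => v; exact: pr_ge0.
Qed.

Lemma pr_le1 s n y z : pr c s n y z <= 1.
Proof. by rewrite -(pr_sum s n y); apply: esum_ge_term => v; exact: pr_ge0. Qed.

Lemma prE s n y z : (fine (pr c s n y z))%:E = pr c s n y z.
Proof.
by rewrite fineK// ge0_fin_numE ?pr_ge0// (le_lt_trans (pr_le1 _ _ _ _))// ltry.
Qed.

Lemma pr_forward s n y z :
  pr c s n.+1 y z =
  \esum_(w in [set: V]) ((jump (c (s + n)%N) w z)%:E * pr c s n y w).
Proof.
elim: n s y => [|n IH] s y.
  rewrite addn0 /= (@esum_pred1 _ _ _ z) ?eqxx ?mule1//; last first.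
    by move=> v /negPf ->; rewrite mule0.
  rewrite (@esum_pred1 _ _ _ y) ?eqxx ?mule1//.
  by move=> v; rewrite eq_sym => /negPf ->; rewrite mule0.
rewrite -[LHS]/(\esum_(w in [set: V]) ((jump (c s) y w)%:E * pr c s.+1 n.+1 w z)).
under eq_esum => w _.
  rewrite IH.
  rewrite -esumZl ?jump_ge0//; last by move=> v; rewrite mule_ge0// pr_ge0.
  over.
rewrite esum_swap; last by move=> ? ?; rewrite !mule_ge0// pr_ge0.
apply: eq_esum => w _ /=; rewrite addSnnS -esumZl ?jump_ge0//; last first.
  by move=> v; rewrite mule_ge0// pr_ge0.
by apply: eq_esum => v _; rewrite muleCA.
Qed.

Variable x : V.

(* The density of the law at time [t] with respect to the reversing measure of [c t]. *)
Definition dens t v : R := (fine (pr c 0 t x v) / wt (c t) v)%R.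

Lemma densE t v : (wt (c t) v * dens t v)%:E = pr c 0 t x v.
Proof. by rewrite /dens mulrC divfK ?prE// gt_eqF// (env_wt_gt0 ce). Qed.

Lemma dens_ge0 t v : (0 <= dens t v)%R.
Proof.
by apply: divr_ge0; [exact: fine_ge0 (pr_ge0 _ _ _ _)|exact: wt_ge0].
Qed.
Hint Resolve dens_ge0 : core.

Lemma dens_step t z :
  (wt (c t.+1) z * dens t.+1 z)%:E = \esum_(y in [set: V]) (c t y z * dens t y)%:E.
Proof.
rewrite densE pr_forward add0n; apply: eq_esum => y _.
rewrite -prE -EFinM /jump /dens -/(wt _ _); congr EFin; ring.
Qed.

(** Maximum principle: by symmetry the new density at [v] comes from a sum bounded by the old
    supremum times pi_t(v), and pi_t(v) <= pi_(t+1)(v). *)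
Lemma dens_le t v : (dens t v <= (wt (c 0%N) x)^-1)%R.
Proof.
elim: t v => [|t IH] v.
  rewrite /dens /=; have [->|_] := eqVneq x v; first by rewrite div1r.
  by rewrite mul0r invr_ge0 wt_ge0.
have w0 := env_wt_gt0 ce t.+1 v.
rewrite -(ler_pM2l w0) -lee_fin dens_step.
have i0 : (0 <= (wt (c 0%N) x)^-1)%R by rewrite invr_ge0 wt_ge0.
apply: (@le_trans _ _ ((wt (c 0%N) x)^-1%:E * total_cond (c t) v)).
  rewrite -esumZl//; last by move=> w; rewrite lee_fin; case: (cn t) => -[].
  apply: le_esum => y _; rewrite -EFinM lee_fin mulrC.
  have [[cC c0] _] := cn t; rewrite cC; exact: ler_wpM2r.
rewrite -(wtE _ (cn t)) -EFinM lee_fin mulrC ler_wpM2r//.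
by apply: wt_le => //; apply: env_le.
Qed.

Lemma mform_dens_step t (g : V -> R) : nneg g ->
  mform (wt (c t.+1)) (dens t.+1) g = bform (c t) (dens t) g.
Proof.
move=> g0; rewrite bformE//; apply: eq_esum => v _.
rewrite mulrC EFinM dens_step -esumZl//; last first.
  by move=> y; rewrite lee_fin mulr_ge0//; case: (cn t) => -[].
by apply: eq_esum => u _; rewrite -EFinM mulrC.
Qed.

Lemma mform_dens0 (g : V -> R) : nneg g -> mform (wt (c 0%N)) (dens 0) g = (g x)%:E.
Proof.
move=> g0; rewrite /mform (@esum_pred1 _ _ _ x).
- by rewrite EFinM densE/= eqxx mul1e.
- by move=> v; rewrite eq_sym EFinM densE/= => /negPf ->; rewrite mul0e.
- by rewrite lee_fin; do ![exact: dens_ge0|exact: wt_ge0|exact: g0|apply: mulr_ge0].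
Qed.

Lemma mform_dens_le t (g : V -> R) K : (0 <= K)%R -> nneg g -> (forall v, (g v <= K)%R) ->
  mform (wt (c t)) (dens t) g <= K%:E.
Proof.
move=> K0 g0 gK; rewrite -[leRHS]mule1 -(pr_sum 0 t x) -esumZl//; last first.
  by move=> v; exact: pr_ge0.
apply: le_esum => v _; rewrite mulrC EFinM densE lee_wpmul2r ?pr_ge0//.
by rewrite lee_fin.
Qed.

(** F_k of the overview, with [n] terms starting at time [k]. *)
Definition occd k n v : R := (\sum_(i < n) dens (k + i) v)%R.

Lemma occd0 k : occd k 0 = cst 0%R.
Proof. by apply/funext => v; rewrite /occd big_ord0. Qed.

Lemma occdS k n : occd k n.+1 = (dens k \+ occd k.+1 n)%R.
Proof.
apply/funext => v; rewrite /occd big_ord_recl addn0; congr (_ + _)%R.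
by apply: eq_bigr => i _; rewrite lift0 addSnnS.
Qed.

Lemma occdSr k n : occd k n.+1 = (occd k n \+ dens (k + n)%N)%R.
Proof. by apply/funext => v; rewrite /occd big_ord_recr. Qed.

Lemma occd_ge0 k n v : (0 <= occd k n v)%R.
Proof. by rewrite /occd sumr_ge0. Qed.
Hint Resolve occd_ge0 : core.

Lemma occd_le k n v : (occd k n v <= n%:R * (wt (c 0%N) x)^-1)%R.
Proof.
rewrite /occd; apply: (@le_trans _ _ (\sum_(i < n) (wt (c 0%N) x)^-1)%R).
  by apply: ler_sum => i _; exact: dens_le.
by rewrite sumr_const card_ord mulr_natl.
Qed.

(** A crude bound growing with [n], used for finiteness: each law has mass 1, and the weight at time
    [j] is below those at all later times. *)
Lemma mform_occd_le j k n (g : V -> R) K : (j <= k)%N ->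
  (0 <= K)%R -> nneg g -> (forall v, (g v <= K)%R) ->
  mform (wt (c j)) (occd k n) g <= (n%:R * K)%:E.
Proof.
move=> + K0 g0 gK; elim: n k => [|n IH] k jk.
  rewrite occd0 mul0r /mform esum1// => v _.
  by rewrite mulr0 mul0r.
rewrite occdS mformC mformDr//; last by move=> v; exact: wt_ge0.
rewrite mulrSr mulrDl mul1r addrC EFinD leeD//.
  by rewrite mformC; apply: IH; exact: leqW.
apply: le_trans (mform_dens_le k K0 g0 gK); rewrite mformC; apply: le_esum => v _.
by rewrite lee_fin !ler_wpM2r//; apply: wt_le => //; exact: (env_le ce).
Qed.

Lemma mform_occd_fin j k n : (j <= k)%N ->
  mform (wt (c j)) (occd k n) (occd k n) < +oo.
Proof.
move=> jk; apply: le_lt_trans (ltry (n%:R * (n%:R * (wt (c 0%N) x)^-1))).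
apply: mform_occd_le => //; last exact: occd_le.
by rewrite mulr_ge0// invr_ge0 wt_ge0.
Qed.

End chain.

(** * Energy of the accumulated density *)

Lemma ge0_real {R : realType} (x : \bar R) : 0 <= x -> x < +oo ->
  exists2 r : R, (0 <= r)%R & x = r%:E.
Proof.
move=> x0 xy; exists (fine x); first exact: fine_ge0.
by rewrite fineK// ge0_fin_numE.
Qed.

Lemma bounded_sum_small {R : realType} (a : nat -> R) (r e : R) : (0 < e)%R ->
  (forall n, \sum_(i < n) a i <= r)%R -> exists n, (a n < e)%R.
Proof.
move=> e0 ar; apply: contrapT => /forallNP H.
have Hn n : (n%:R * e <= r)%R.
  apply: le_trans (ar n); rewrite mulr_natl -[in leLHS](card_ord n) -sumr_const.
  by apply: ler_sum => i _; rewrite leNgt; exact/negP.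
have := Hn (Num.truncn (r / e)).+1.
by rewrite leNgt -ltr_pdivrMr// truncnS_gt.
Qed.

Section energy_estimates.
Context {R : realType} {V : countType}.
Variables (c : nat -> V -> V -> R) (ce : environment c) (x : V).

Let cn t : network (c t) := env_network ce t.
Local Notation dens := (dens c x).
Local Notation occd := (occd c x).
Let d0 t v : (0 <= dens t v)%R := dens_ge0 ce x t v.
Let o0 k n v : (0 <= occd k n v)%R := occd_ge0 ce x k n v.
Let w0 t v : (0 <= wt (c t) v)%R := wt_ge0 v (cn t).

Lemma occd_bounded k n : exists2 K : R, (0 <= K)%R & forall v, (occd k n v <= K)%R.
Proof.
exists (n%:R * (wt (c 0%N) x)^-1)%R; last by move=> v; exact: occd_le.
by rewrite mulr_ge0// invr_ge0 w0.
Qed.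

(** Write d, F, G for f_k, F_(k+1), F_k. In the expansion of E_k(G) = E_k(d + F), the induction
    hypothesis bounds E_k(F) by 2A_(k+1)(f_(k+1),F) = 2B_k(d,F), which cancels the cross term
    -2B_k(d,F); the rest is at most 2A_k(d,G). *)
Lemma energy_occd k n :
  energy (c k) (occd k n) <= 2%:E * mform (wt (c k)) (dens k) (occd k n).
Proof.
elim: n k => [|n IH] k.
  rewrite occd0 /energy esum1 ?mule0; last first.
    by move=> e _; rewrite /= subrr expr0n/= mulr0.
  by rewrite mule_ge0// mform_ge0.
set d := dens k; set F := occd k.+1 n; set G := occd k n.+1.
have GE : G = (d \+ F)%R by exact: occdS.
have dF : nneg (d \+ F)%R by move=> v; rewrite addr_ge0// ?d0 ?o0.
have [K K0 FK] := occd_bounded k.+1 n.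
have := mform_dens_le ce x k K0 (o0 k.+1 n) FK.
rewrite -/d -/F => /le_lt_trans/(_ (ltry _)) AdF.
have i0 : (0 <= (wt (c 0%N) x)^-1)%R by rewrite invr_ge0 w0.
have := mform_dens_le ce x k i0 (d0 k) (dens_le ce x k).
rewrite -/d => /le_lt_trans/(_ (ltry _)) Add.
have := mform_occd_fin ce x n (leqnSn k); rewrite -/F => AFF.
have [add add0 addE] := ge0_real (mform_ge0 (w0 k) (d0 k) (d0 k)) Add.
have [adf adf0 adfE] := ge0_real (mform_ge0 (w0 k) (d0 k) (o0 k.+1 n)) AdF.
have [aff aff0 affE] := ge0_real (mform_ge0 (w0 k) (o0 k.+1 n) (o0 k.+1 n)) AFF.
have bnd (f : V -> R) : nneg f -> bform (c k) f f <= mform (wt (c k)) f f.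
  by move=> f0; rewrite -energy_bform// leeDr// energy_ge0.
have [bdd bdd0 bddE] := ge0_real (bform_ge0 (cn k) (d0 k) (d0 k))
  (le_lt_trans (bnd _ (d0 k)) Add).
have [bff bff0 bffE] := ge0_real (bform_ge0 (cn k) (o0 k.+1 n) (o0 k.+1 n))
  (le_lt_trans (bnd _ (o0 k.+1 n)) AFF).
have bdfy : bform (c k) d F < +oo.
  rewrite -(mform_dens_step ce x k (o0 k.+1 n)).
  have := mform_dens_le ce x k.+1 K0 (o0 k.+1 n) FK.
  by move=> /le_lt_trans; apply; exact: ltry.
have [bdf bdf0 bdfE] := ge0_real (bform_ge0 (cn k) (d0 k) (o0 k.+1 n)) bdfy.
have EF := energy_bform (cn k) (o0 k.+1 n).
have EG := energy_bform (cn k) dF.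
have := IH k.+1; rewrite (mform_dens_step ce x k (o0 k.+1 n)) -/F bdfE.
have := energy_le F (cn k) (cn k.+1) (env_le ce (leqnSn k)).
move=> /le_trans /[apply].
rewrite GE; move: EF EG.
rewrite !(mformDr (w0 k) _ (d0 k) (o0 k.+1 n))//; last exact: d0.
rewrite !(bformDr (cn k) _ (d0 k) (o0 k.+1 n))//.
rewrite !(mformC _ (d \+ F)%R) !(mformDr (w0 k) _ (d0 k) (o0 k.+1 n)); last 2 first.
- exact: o0.
- exact: d0.
rewrite (bformC (cn k) dF (d0 k)) (bformC (cn k) dF (o0 k.+1 n)).
rewrite !(bformDr (cn k) _ (d0 k) (o0 k.+1 n)); last 2 first.
- exact: o0.
- exact: d0.
rewrite (mformC _ F d) (bformC (cn k) (o0 k.+1 n) (d0 k)).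
rewrite !(addE, adfE, affE, bddE, bffE, bdfE).
case: (energy (c k) F) => [eF| |]//; case: (energy (c k) (d \+ F)%R) => [eG| |]//.
rewrite -!EFinD -!EFinM !lee_fin => -[EF] -[EG]; clear -EF EG bdd0 add0; lra.
Qed.

(** Summing A(f_(t+1),g) = B(f_t,g) telescopes against A - B: the gradient of the accumulated
    density is a flow from the law at time [k] to the law at time [k + n]. *)
Lemma mform_occd_telescope k n (g : V -> R) : (forall t, c t = c 0%N) -> nneg g ->
  mform (wt (c 0%N)) (occd k n) g + mform (wt (c 0%N)) (dens (k + n)%N) g =
  mform (wt (c 0%N)) (dens k) g + bform (c 0%N) (occd k n) g.
Proof.
move=> cc g0; elim: n k => [|n IH] k.
  rewrite occd0 addn0 [X in X + _]esum1; last by move=> v _; rewrite mulr0 mul0r.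
  rewrite [X in _ = _ + X]esum1; last by move=> v _; rewrite mulr0 mul0r.
  by rewrite addeC.
have dF : nneg (dens k \+ occd k.+1 n)%R by move=> v; rewrite addr_ge0// ?d0 ?o0.
rewrite (occdS c x) (mformC _ _ g) (mformDr (w0 0) g0 (d0 k) (o0 k.+1 n)).
rewrite (mformC _ g (dens k)) (mformC _ g (occd k.+1 n)).
rewrite -addeA -(addSnnS k n) (IH k.+1).
rewrite (bformC (cn 0) dF g0) (bformDr (cn 0) g0 (d0 k) (o0 k.+1 n)).
rewrite (bformC (cn 0) g0 (d0 k)) (bformC (cn 0) g0 (o0 k.+1 n)).
by have := mform_dens_step ce x k g0; rewrite !cc => ->.
Qed.

(** Reversibility moves a step from one factor to the other, A(f_(a+1),f_b) = B(f_a,f_b) =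
    A(f_a,f_(b+1)), until the first law is the unit mass at [x]. *)
Lemma mform_dens_dens a b : (forall t, c t = c 0%N) ->
  mform (wt (c 0%N)) (dens a) (dens b) = (dens (a + b)%N x)%:E.
Proof.
move=> cc; elim: a b => [|a IH] b; first exact: mform_dens0.
have := mform_dens_step ce x a (d0 b); rewrite !cc => ->.
rewrite (bformC (cn 0) (d0 a) (d0 b)).
have := mform_dens_step ce x b (d0 a); rewrite !cc => <-.
by rewrite mformC IH addSnnS.
Qed.

Lemma mform_dens_occd k n : (forall t, c t = c 0%N) ->
  mform (wt (c 0%N)) (dens k) (occd k n) = (\sum_(i < n) dens (k.*2 + i)%N x)%:E.
Proof.
move=> cc; suff H l : mform (wt (c 0%N)) (dens k) (occd l n) =
    (\sum_(i < n) dens (k + l + i)%N x)%:E by rewrite H addnn.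
elim: n l => [|n IH] l.
  by rewrite occd0 big_ord0 /mform esum1// => v _; rewrite mulr0.
rewrite occdS (mformDr (w0 0) (d0 k) (d0 l) (o0 l.+1 n)) IH mform_dens_dens//.
rewrite big_ord_recl addn0 EFinD; congr (_ + _).
by congr EFin; apply: eq_bigr => i _; rewrite lift0 -addnA addSnnS addnA.
Qed.

(* The pairing with the law at time [k] is that with a flow to infinity of
   energy at most [2 r]. *)
Lemma mform_dens_energy k (r l : R) (h : V -> R) : (forall t, c t = c 0%N) ->
  nneg h -> mform (wt (c 0%N)) h h < +oo -> (0 <= l)%R ->
  (forall n, \sum_(i < n) dens (k.*2 + i)%N x <= r)%R ->
  (2 * l)%:E * mform (wt (c 0%N)) (dens k) h <=
    (l ^+ 2)%:E * energy (c 0%N) h + (2 * r)%:E.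
Proof.
move=> cc h0 hy l0 dr.
have w0' := w0 0.
have [hh hh0 hhE] := ge0_real (mform_ge0 w0' h0 h0) hy.
have fin_mdh j : mform (wt (c 0%N)) (dens j) h < +oo.
  have := mform_cauchy w0' (d0 j) h0 (@ler01 R).
  rewrite mulr1 expr1n mul1e mform_dens_dens// hhE -EFinD.
  have := mform_ge0 w0' (d0 j) h0.
  by case: (mform _ _ h) => [s| |]//; rewrite ?ltry// gt0_muley// lte_fin.
have [eh eh0 ehE] : exists2 e : R, (0 <= e)%R & energy (c 0%N) h = e%:E.
  apply: ge0_real (energy_ge0 _ (cn 0)) _.
  by rewrite (le_lt_trans _ hy)// -energy_bform// leeDl// bform_ge0.
have [a a0 aE] := ge0_real (mform_ge0 w0' (d0 k) h0) (fin_mdh k).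
rewrite aE ehE -!EFinM -EFinD lee_fin; apply/ler_addgt0Pr => e e0.
(* The far end of the flow is negligible for some [n]: bounded sums force small return densities at
   even times. Cauchy-Schwarz with weight [eta] leaves the error [eta * l * hh], which the choice of
   [eta] keeps below [e / 2]. *)
have [n dn] : exists n, (2%:E * l%:E * mform (wt (c 0%N)) (dens (k + n)%N) h <= e%:E).
  pose eta := (e / (2 * (l * hh + 1)))%R.
  have lh0 : (0 < l * hh + 1)%R by rewrite ltr_wpDl ?mulr_ge0.
  have eta0 : (0 < eta)%R by rewrite divr_gt0// mulr_gt0.
  have [n dn] : exists n, (l * dens (k.*2 + n.*2)%N x < eta * (e / 2))%R.
    apply: (@bounded_sum_small _ _ (l * r)%R); first by rewrite mulr_gt0// divr_gt0.
    move=> n; rewrite -mulr_sumr ler_wpM2l//; apply: le_trans (dr n.*2).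
    elim: n => [|n IHn]; first by rewrite !big_ord0.
    rewrite doubleS 3!big_ord_recr/= -addrA lerD// lerDl d0//.
  exists n; have := mform_cauchy w0' (d0 (k + n)%N) h0 (ltW eta0).
  rewrite mform_dens_dens// addnn doubleD hhE.
  have [b b0 ->] := ge0_real (mform_ge0 w0' (d0 (k + n)%N) h0) (fin_mdh (k + n)%N).
  rewrite -!EFinM -EFinD !lee_fin => H.
  rewrite -(ler_pM2l eta0).
  have := ler_wpM2l l0 H.
  have : (eta * (l * hh + 1) = e / 2)%R by rewrite /eta; field; rewrite gt_eqF.
  clear -dn eta0 b0 hh0 l0; nra.
(* Cauchy-Schwarz between F = [occd k n] and [h]: by telescoping, A - B is the wanted pairing minus
   the far end, while E(F) <= 2A(f_k,F) <= 2r. *)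
have := energy_cauchy (cn 0) (o0 k n) h0 l0.
have := mform_occd_telescope k n cc h0.
have := energy_occd k n; rewrite cc mform_dens_occd// -EFinM.
have ohy j : mform (wt (c 0%N)) (occd k j) h < +oo.
  elim: j => [|j IHj].
    by rewrite occd0 /mform esum1// => v _; rewrite mulr0 mul0r.
  rewrite (occdSr c x) mformC (mformDr w0' h0 (o0 k j) (d0 (k + j)%N)).
  rewrite (mformC _ h (occd k j)) (mformC _ h (dens (k + j)%N)).
  by rewrite lte_add_pinfty.
have [oh oh0 ->] := ge0_real (mform_ge0 w0' (o0 k n) h0) (ohy n).
have := bform_ge0 (cn 0) (o0 k n) h0.
have [b b0 bE] := ge0_real (mform_ge0 w0' (d0 (k + n)%N) h0) (fin_mdh (k + n)%N).
move: dn; rewrite bE aE ehE.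
case: (bform _ _ _) => [bo| |]//; case: (energy _ (occd k n)) => [eo| |]//.
rewrite -!EFinM -!EFinD !lee_fin => H1 _ H2 [H3] H4.
have := dr n; have : (l * oh + l * b = l * a + l * bo)%R by rewrite -!mulrDr H3.
clear -H1 H2 H4; lra.
Qed.

End energy_estimates.

(** * Effective resistance to infinity *)

Section effective_resistance.
Context {R : realType}.

(** Values never exceed the supremum, so only the lower end of a neighbourhood matters; one finite
    set passes it, and by monotonicity so do all larger ones. *)
Lemma lim_totally_sup (T : choiceType) (f : {fset T} -> \bar R) :
  (forall A B : {fset T}, fsubset A B -> f A <= f B) ->
  lim (f @ totally) = ereal_sup (range f).
Proof.
move=> fm; have tF := @totally_filter T.
apply: cvg_lim => //; set l := ereal_sup _.
have fl B : f B <= l by apply: ereal_sup_ubound; exists B.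
move=> U /=; rewrite itv_nbhsE => -[[a b] [/= ope li] abU].
suff [B0 aB0] : exists B0, (a <= BLeft (f B0))%O.
  exists B0 => // B /= B0B; apply: abU => /=.
  move: li; rewrite !itv_boundlr => /andP[_ lb]; apply/andP; split.
    by apply: (le_trans aB0); rewrite bnd_simp; exact: fm.
  by apply: le_trans lb; rewrite bnd_simp.
move: ope li; rewrite itv_boundlr => ope /andP[al _].
case: a ope al {abU} => [[] a|[]] ope //=.
- rewrite bnd_simp => /ereal_sup_gt[_ [B _ <-] aB].
  by exists B; rewrite bnd_simp.
- by move=> _; exists fset0; rewrite bnd_simp.
Qed.

Context {V : countType}.
Implicit Types (c : V -> V -> R) (f g : V -> R) (x : V).

Lemma energyZ c f (k : R) :
  network c -> energy c (fun v => k * f v)%R = (k ^+ 2)%:E * energy c f.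
Proof.
move=> [[_ c0] _]; rewrite /energy muleCA; congr (_ * _).
rewrite -esumZl ?sqr_ge0//; last by move=> e; rewrite lee_fin mulr_ge0// sqr_ge0.
by apply: eq_esum => e _; rewrite -EFinM; congr EFin; ring.
Qed.

Lemma eff_res_le c x (A B : {fset V}) : network c -> fsubset A B ->
  eff_res c [set x] (~` [set` A]) <= eff_res c [set x] (~` [set` B]).
Proof.
move=> nc /fsubsetP AB; rewrite /eff_res lee_pV2.
- apply: ereal_inf_le_tmp => _ /= [f [fx fB] <-]; exists f => //.
  by split => // v vB; apply: fB => vA; apply: vB; exact: AB.
- by rewrite inE; apply/ereal_infP => _ /= [f _ <-]; exact: energy_ge0.
- by rewrite inE; apply/ereal_infP => _ /= [f _ <-]; exact: energy_ge0.
Qed.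

Lemma eff_res_inftyE c x : network c ->
  eff_res_infty c x =
  ereal_sup (range (fun B : {fset V} => eff_res c [set x] (~` [set` B]))).
Proof. by move=> nc; rewrite /eff_res_infty lim_totally_sup// => A B; exact: eff_res_le. Qed.

Lemma eff_res_infty_ge0 c x : network c -> 0 <= eff_res_infty c x.
Proof.
move=> nc; rewrite eff_res_inftyE//.
apply: (@le_trans _ _ (eff_res c [set x] (~` [set` fset0]))); last first.
  by apply: ereal_sup_ubound; exists fset0.
by rewrite inve_ge0; apply/ereal_infP => _ /= [f _ <-]; exact: energy_ge0.
Qed.

Lemma eff_res_energy c x (B : {fset V}) f (r e : R) : network c ->
  eff_res_infty c x = r%:E -> f x = 1%R -> (forall v, v \notin B -> f v = 0%R) ->
  energy c f = e%:E -> (1 <= r * e)%R.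
Proof.
move=> nc cr fx fB fe.
have e0 : (0 <= e)%R by rewrite -lee_fin -fe energy_ge0.
have : e%:E^-1 <= r%:E.
  rewrite -cr eff_res_inftyE//.
  apply: (@le_trans _ _ (eff_res c [set x] (~` [set` B]))); last first.
    by apply: ereal_sup_ubound; exists B.
  rewrite /eff_res lee_pV2 ?inE//; last first.
    by apply/ereal_infP => _ /= [g _ <-]; exact: energy_ge0.
  apply: ge_ereal_inf; exists e%:E => //; exists f => //; split => [v ->//|v /negP].
  exact: fB.
(* Zero energy would make the inverse [+oo], which is not below the real [r]. *)
move: e0; rewrite le_eqVlt => /predU1P[<-|e0]; first by rewrite inve0.
by rewrite inver gt_eqF// lee_fin -[(_^-1)%R]mul1r ler_pdivrMr.
Qed.

(** [F] need not have finite support, so it is truncated to a finite set carrying nearly all of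
    B(F,F). Since E = A - B and truncation does not raise A, the energy grows by an arbitrarily
    small amount at most. Dividing by [F x] gives an admissible potential. *)
Lemma eff_res_infty_sqr c x F (r : R) : network c -> nneg F ->
  mform (wt c) F F < +oo -> eff_res_infty c x = r%:E ->
  ((F x) ^+ 2)%:E <= r%:E * energy c F.
Proof.
move=> nc F0 Fy cr.
have r0 : (0 <= r)%R by rewrite -lee_fin -cr eff_res_infty_ge0.
have EF := energy_bform nc F0.
have := F0 x; rewrite le_eqVlt => /predU1P[<-|Fx0].
  by rewrite expr0n/= mule_ge0// energy_ge0.
have w0 v := wt_ge0 v nc.
have [m m0 mE] := ge0_real (mform_ge0 w0 F0 F0) Fy.
have by_ : bform c F F < +oo by rewrite (le_lt_trans _ Fy)// -EF leeDr// energy_ge0.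
have [b b0 bE] := ge0_real (bform_ge0 nc F0 F0) by_.
have ey : energy c F < +oo by rewrite (le_lt_trans _ Fy)// -EF leeDl// bform_ge0.
have [e e0 eE] := ge0_real (energy_ge0 F nc) ey.
rewrite eE -EFinM lee_fin; apply/ler_addgt0Pr => eps eps0.
have del0 : (0 < eps / (r + 1))%R by rewrite divr_gt0// ltr_wpDl.
have cFF (uv : V * V) : 0 <= (c uv.1 uv.2 * F uv.1 * F uv.2)%:E.
  by case: nc => -[_ c0] _; rewrite lee_fin !mulr_ge0.
have [E HE] := esum_approx cFF by_ del0.
(* Both endpoints of every retained edge are kept, so its term is unchanged; adding [x] preserves
   the value there. *)
pose B : {fset V} := ([fset e.1 | e in E] `|` [fset e.2 | e in E] `|` [fset x])%fset.
pose FB v := if v \in B then F v else 0%R.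
have FB0 v : (0 <= FB v)%R by rewrite /FB; case: ifP.
have FBx : FB x = F x by rewrite /FB !inE eqxx orbT.
have bB : bform c F F <= bform c FB FB + (eps / (r + 1))%:E.
  apply: (le_trans HE); rewrite leeD2r//; apply: le_esum => -[u v] _ /=.
  case: ifPn => uvE.
    have uB : u \in B.
      by rewrite !inE; apply/orP; left; apply/orP; left; apply/imfsetP; exists (u, v).
    have vB : v \in B.
      by rewrite !inE; apply/orP; left; apply/orP; right; apply/imfsetP; exists (u, v).
    by rewrite /FB uB vB.
  by case: nc => -[_ c0] _; rewrite lee_fin !mulr_ge0.
have mB : mform (wt c) FB FB <= mform (wt c) F F.
  apply: le_esum => v _; rewrite lee_fin -!mulrA ler_wpM2l//.
  by rewrite /FB; case: ifP => // _; rewrite mul0r mulr_ge0.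
have EFB := energy_bform nc FB0.
have [mb mb0 mbE] := ge0_real (mform_ge0 w0 FB0 FB0) (le_lt_trans mB Fy).
move: EF EFB bB mB; rewrite mE bE eE mbE.
have := energy_ge0 FB nc; have := bform_ge0 nc FB0 FB0.
case eb : (energy c FB) => [eB| |]//; case: (bform c FB FB) => [bb| |]//.
rewrite -!EFinD !lee_fin => bb0 eB0 [EF] [EFB] bB mB.
have := @eff_res_energy c x B (fun v => (F x)^-1 * FB v)%R r ((F x)^-1 ^+ 2 * eB)%R nc cr.
rewrite energyZ// eb -EFinM FBx mulVf ?gt_eqF// => /(_ erefl).
have off v : v \notin B -> ((F x)^-1 * FB v = 0)%R.
  by move=> vB; rewrite /FB (negPf vB) mulr0.
move=> /(_ off erefl) H.
have F20 : (0 < F x ^+ 2)%R by rewrite exprn_gt0.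
have {}H : (F x ^+ 2 <= r * eB)%R.
  by move: H; rewrite mulrCA exprVn ler_pdivlMl// mulr1.
apply: (le_trans H); apply: (@le_trans _ _ (r * (e + eps / (r + 1)))%R).
  by rewrite ler_wpM2l//; clear -EF EFB bB mB; lra.
rewrite mulrDr lerD2l mulrCA; apply: ler_piMr; first exact: ltW.
by rewrite ler_pdivrMr ?mul1r ?ltr_wpDl// lerDl.
Qed.

(** Potentials vanishing off a finite set have finite A(f,f), and absolute values do not raise the
    energy. *)
Lemma eff_res_infty_le c x (K : R) : network c -> (0 < K)%R ->
  (forall f, nneg f -> mform (wt c) f f < +oo -> f x = 1%R ->
     1 <= K%:E * energy c f) ->
  eff_res_infty c x <= K%:E.
Proof.
move=> nc K0 H; rewrite eff_res_inftyE//; apply: ge_ereal_sup => _ /= [B _ <-].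
rewrite /eff_res; set S := [set energy c f | f in _].
have S0 : 0 <= ereal_inf S by apply/ereal_infP => _ [g _ <-]; exact: energy_ge0.
rewrite inve_ple ?inE ?lee_fin ?(ltW K0)//.
apply/ereal_infP => _ /= [f [fx fB] <-].
apply: le_trans (energy_abs f nc).
rewrite inver gt_eqF// -[(K^-1)%:E]mule1 lee_pdivrMl//; apply: H => //.
  rewrite /mform (@eq_esum _ _ _ _ (fun v =>
    if v \in [set` B] then (wt c v * `|f v| * `|f v|)%:E else 0)).
    rewrite -esum_mkcond esum_fset//; last first.
      by move=> v _; rewrite lee_fin !mulr_ge0// wt_ge0.
    by rewrite fsbig_finite//= sumEFin ltry.
  by move=> v _; case: ifPn => //; rewrite notin_setE => /fB ->; rewrite normr0 mulr0.
by rewrite fx// normr1.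
Qed.

End effective_resistance.

(** * Expected visits and avoidance *)

Section visits.
Context {R : realType} {V : countType}.
Implicit Types (c : nat -> V -> V -> R) (x y z : V).

Lemma environment_jump_ge0 c s y z : environment c -> 0 <= (jump (c s) y z)%:E.
Proof. by move=> ce; rewrite lee_fin jump_ge0//; exact: env_network. Qed.

Lemma environment_jump_sum c s y : environment c ->
  \esum_(z in [set: V]) (jump (c s) y z)%:E = 1.
Proof. by move=> ce; apply: jump_sum; [exact: env_network|exact: env_wt_gt0]. Qed.

Lemma eq_pr c c' s s' n y z :
  (forall i, (i < n)%N -> c (s + i)%N = c' (s' + i)%N) -> pr c s n y z = pr c' s' n y z.
Proof.
elim: n s s' y => //= n IH s s' y cc'; apply: eq_esum => w _.
have := cc' 0%N isT; rewrite !addn0 => ->; congr (_ * _); apply: IH => i ni.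
by rewrite !addSnnS; exact: cc'.
Qed.

Lemma jump_nE c s n y z : jump_n (c 0%N) n y z = pr (fun=> c 0%N) s n y z.
Proof. by elim: n s y => //= n IH s y; apply: eq_esum => w _; rewrite -IH. Qed.

Variables (c : nat -> V -> V -> R) (ce : environment c).

Let j0 s y z : 0 <= (jump (c s) y z)%:E := environment_jump_ge0 s y z ce.
Let p0 s n y z : 0 <= pr c s n y z := pr_ge0 ce s n y z.

Lemma pr_chapman_kolmogorov s m n y z :
  pr c s (m + n) y z =
  \esum_(w in [set: V]) (pr c s m y w * pr c (s + m) n w z).
Proof.
elim: m s y => [|m IH] s y.
  rewrite addn0 (@esum_pred1 _ _ _ y); first by rewrite /= eqxx mul1e.
    by move=> v /=; rewrite eq_sym => /negPf ->; rewrite mul0e.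
  by rewrite mule_ge0.
rewrite addSn /=; under eq_esum => w _.
  rewrite IH -esumZl ?jump_ge0//; last 2 first.
  - exact: env_network.
  - by move=> v; rewrite mule_ge0.
  over.
rewrite esum_swap; last by move=> ? ?; rewrite !mule_ge0.
apply: eq_esum => w _; rewrite muleC addSnnS -prE// -esumZl ?fine_ge0//; last first.
  by move=> v; rewrite mule_ge0.
by apply: eq_esum => v _; rewrite prE// muleA muleC.
Qed.

(** Counts the times [s] to [s + n - 1], the initial one included. *)
Definition visits s n y x := \sum_(i < n) pr c s i y x.

Lemma visits_ge0 s n y x : 0 <= visits s n y x.
Proof. by rewrite sume_ge0. Qed.

Lemma visitsS s n y x : visits s n.+1 y x =
  (if y == x then 1 else 0) +
  \esum_(z in [set: V]) ((jump (c s) y z)%:E * visits s.+1 n z x).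
Proof.
rewrite /visits big_ord_recl; congr (_ + _).
under [RHS]eq_esum do rewrite ge0_sume_distrr//.
rewrite esum_sum; last by move=> *; rewrite mule_ge0.
by apply: eq_bigr => i _; rewrite lift0.
Qed.

(* Maximum principle: off [x] the expected number of visits to [x] is an
   average of the same quantity one time step later. *)
Lemma visits_le x (K : R) : (forall s n, visits s n x x <= K%:E) ->
  forall s n y, visits s n y x <= K%:E.
Proof.
move=> H s n; elim: n s => [|n IH] s y.
  by apply: le_trans (H s 0%N); rewrite /visits !big_ord0.
have [->|yx] := eqVneq y x; first exact: H.
rewrite visitsS (negPf yx) add0e.
have K0 : (0 <= K)%R by rewrite -lee_fin (le_trans _ (H s 0%N))// visits_ge0.
apply: (@le_trans _ _ (K%:E * \esum_(z in [set: V]) (jump (c s) y z)%:E)).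
  rewrite -esumZl//; apply: le_esum => z _.
  by rewrite muleC lee_wpmul2r.
by rewrite environment_jump_sum// mule1.
Qed.

(* [W] is indexed by absolute time, and the state [y] at the initial time [s] is
   exempt: only the times [s+1, ..., s+n] are constrained. *)
Fixpoint hold (W : nat -> V -> bool) s n y : \bar R :=
  if n is m.+1 then
    \esum_(z in [set: V]) ((jump (c s) y z)%:E *
                           (if W s.+1 z then hold W s.+1 m z else 0))
  else 1.

Lemma holdS W s n y : hold W s n.+1 y =
  \esum_(z in [set: V]) ((jump (c s) y z)%:E *
    (if W s.+1 z then hold W s.+1 n z else 0)).
Proof. by []. Qed.

Lemma hold_ge0 W s n y : 0 <= hold W s n y.
Proof.
elim: n s y => //= n IH s y; apply: esum_ge0 => z _.
by rewrite mule_ge0//; case: ifP.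
Qed.

Lemma hold_le1 W s n y : hold W s n y <= 1.
Proof.
elim: n s y => //= n IH s y; rewrite -(environment_jump_sum s y ce).
apply: le_esum => z _; rewrite -[leRHS]mule1 lee_wpmul2l//.
by case: ifP.
Qed.

Lemma hold_leS W s n y : hold W s n.+1 y <= hold W s n y.
Proof.
elim: n s y => [|n IH] s y; first exact: hold_le1.
rewrite (holdS W s n.+1) (holdS W s n).
by apply: le_esum => z _; rewrite lee_wpmul2l//; case: ifP.
Qed.

Lemma hold_le W s m n y : (m <= n)%N -> hold W s n y <= hold W s m y.
Proof.
elim: n => [|n IH]; first by rewrite leqn0 => /eqP ->.
by rewrite leq_eqVlt => /predU1P[->//|/IH]; apply: le_trans; exact: hold_leS.
Qed.

(** As the initial state is exempt, [avoid x s n x] is the probability of not returning to [x]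
    within [n] steps. *)
Definition avoid x := hold (fun _ v => v != x).

Lemma avoidS x s n y : avoid x s n.+1 y =
  \esum_(z in [set: V]) ((jump (c s) y z)%:E * (if z == x then 0 else avoid x s.+1 n z)).
Proof. by apply: eq_esum => z _; case: eqP. Qed.

(** Markov's inequality for the number of visits, proved by first-step decomposition. The count has
    [n.+1] terms because it includes time [s]. *)
Lemma avoid_visits x s n y : y != x -> 1 <= avoid x s n y + visits s n.+1 y x.
Proof.
elim: n s y => [|n IH] s y yx; first by rewrite leeDl ?visits_ge0.
rewrite visitsS (negPf yx) add0e avoidS -esumD; last 2 first.
- by move=> z _; rewrite mule_ge0//; case: ifP => // _; exact: hold_ge0.
- by move=> z _; rewrite mule_ge0// visits_ge0.
rewrite -{1}(environment_jump_sum s y ce); apply: le_esum => z _.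
rewrite -ge0_muleDr ?visits_ge0//; last by case: ifP => // _; exact: hold_ge0.
rewrite -{1}[_%:E]mule1 lee_wpmul2l//; have [->|zx] := eqVneq z x; last exact: IH.
by rewrite add0e visitsS eqxx leeDl// esum_ge0// => w _; rewrite mule_ge0// visits_ge0.
Qed.

End visits.

Lemma summable_tail {R : realType} (a : nat -> R) (r e : R) :
  (forall n, 0 <= a n)%R -> (0 < e)%R -> (forall n, \sum_(i < n) a i <= r)%R ->
  exists K, forall k n, (K <= k)%N -> (\sum_(i < n) a (k + i)%N <= e)%R.
Proof.
move=> a0 e0 ar; pose S := range (fun n => \sum_(i < n) a i)%R.
have hS : has_sup S.
  by split; [exists 0%R, 0%N => //; rewrite big_ord0|exists r => _ [n _ <-]].
have [_ [K _ <-] HK] := sup_adherent e0 hS; exists K => k n Kk.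
have := @sup_upper_bound _ S hS (\sum_(i < k + n) a i)%R (ex_intro2 _ _ (k + n)%N I erefl).
have : (\sum_(i < K) a i <= \sum_(i < k) a i)%R.
  by rewrite -(subnKC Kk) big_split_ord/= lerDl sumr_ge0.
rewrite big_split_ord/=; move: HK; clear; lra.
Qed.

(** * The walk on a fixed network *)

Section homogeneous.
Context {R : realType} {V : countType}.

Lemma eq_hold (c c' : nat -> V -> V -> R) W W' s s' n y :
  (forall i, (i < n)%N -> c (s + i)%N = c' (s' + i)%N) ->
  (forall i z, (i < n)%N -> W (s + i).+1 z = W' (s' + i).+1 z) ->
  hold c W s n y = hold c' W' s' n y.
Proof.
elim: n s s' y => //= n IH s s' y cc' WW'; apply: eq_esum => z _.
have := cc' 0%N isT; have := WW' 0%N z isT; rewrite !addn0 => -> ->.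
congr (_ * _); case: ifP => // _; apply: IH => [i|i v] ni.
  by rewrite !addSnnS; exact: cc'.
by rewrite !addSnnS; exact: WW'.
Qed.

Variable k : V -> V -> R.
Hypothesis ke : environment (fun=> k).
Local Notation c := (fun _ : nat => k).

Let j0 y z : 0 <= (jump k y z)%:E := environment_jump_ge0 0%N y z ke.
Let p0 s n y z : 0 <= pr c s n y z := pr_ge0 ke s n y z.
Let a0 x s n y : 0 <= avoid c x s n y := hold_ge0 ke (fun _ v => v != x) s n y.

Lemma pr_cst s s' n y z : pr c s n y z = pr c s' n y z.
Proof. exact: eq_pr. Qed.

Lemma avoid_cst x s s' n y : avoid c x s n y = avoid c x s' n y.
Proof. exact: eq_hold. Qed.

(* Renewal: decompose according to the last visit to [x] before time [n]. *)
Lemma last_visit x n y :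
  \sum_(i < n.+1) pr c 0 i y x * avoid c x 0 (n - i) x +
  (if y == x then 0 else avoid c x 0 n y) = 1.
Proof.
elim: n y => [|n IH] y.
  by rewrite big_ord1 /=; case: ifP => _; rewrite ?mule1 ?adde0 ?add0e.
rewrite big_ord_recl subn0 -addeA [X in _ + X]addeC addeA.
have -> : pr c 0 (@ord0 n.+1) y x * avoid c x 0 n.+1 x +
    (if y == x then 0 else avoid c x 0 n.+1 y) = avoid c x 0 n.+1 y.
  by rewrite /=; have [->|_] := eqVneq y x; rewrite ?mul1e ?adde0// mul0e add0e.
have -> : \sum_(i < n.+1) pr c 0 (lift ord0 i) y x * avoid c x 0 (n.+1 - lift ord0 i) x =
   \esum_(z in [set: V]) ((jump k y z)%:E *
     \sum_(i < n.+1) pr c 0 i z x * avoid c x 0 (n - i) x).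
  under [RHS]eq_esum => z _.
    rewrite ge0_sume_distrr; last by move=> i _; rewrite mule_ge0.
    over.
  rewrite esum_sum; last by move=> *; rewrite !mule_ge0.
  apply: eq_bigr => i _; rewrite lift0 subSS.
  have av1 : avoid c x 0 (n - i) x = (fine (avoid c x 0 (n - i) x))%:E.
    by rewrite fineK// ge0_fin_numE// (le_lt_trans (hold_le1 ke _ _ _ _))// ltry.
  rewrite av1 muleC /= -esumZl ?fine_ge0//; last by move=> z; rewrite mule_ge0.
  by apply: eq_esum => z _; rewrite (pr_cst 1 0) muleC muleA.
rewrite avoidS -esumD; last 2 first.
- by move=> z _; rewrite mule_ge0//; case: ifP.
- by move=> z _; rewrite mule_ge0// sume_ge0// => *; rewrite mule_ge0.
rewrite -[RHS](environment_jump_sum 0 y ke); apply: eq_esum => z _.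
rewrite -ge0_muleDr; last 2 first.
- by case: ifP.
- by rewrite sume_ge0// => *; rewrite mule_ge0.
by rewrite addeC (avoid_cst x 1 0) IH mule1.
Qed.

Lemma visits_of_escape x (rho : R) : (0 < rho)%R ->
  (forall n, rho%:E <= avoid c x 0 n x) ->
  forall n, visits c 0 n x x <= (rho^-1)%:E.
Proof.
move=> rho0 H [|n]; first by rewrite /visits big_ord0 lee_fin invr_ge0 ltW.
rewrite -[leRHS]mule1 -(last_visit x n x) eqxx adde0 lee_pdivlMl//.
rewrite /visits ge0_sume_distrr//; apply: lee_sum => i _.
by rewrite muleC lee_wpmul2l.
Qed.

Lemma visitsEFin s n y z :
  visits c s n y z = (\sum_(i < n) fine (pr c 0 i y z))%:E.
Proof.
by rewrite -sumEFin; apply: eq_bigr => i _; rewrite (pr_cst s 0) prE.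
Qed.

(** Use the renewal identity over [K + n] steps. Last visits from time [K] on contribute at most
    1/2; earlier ones leave at least [n] steps to avoid [x], so together they contribute at most [G]
    times the avoidance over [n] steps. *)
Lemma escape_of_visits x (G : R) :
  (forall n, visits c 0 n x x <= G%:E) ->
  exists2 rho : R, (0 < rho)%R & forall n, rho%:E <= avoid c x 0 n x.
Proof.
move=> H; pose a i := fine (pr c 0 i x x).
have ha0 i : (0 <= a i)%R by rewrite fine_ge0.
have aG n : (\sum_(i < n) a i <= G)%R by rewrite -lee_fin -(visitsEFin 0).
have h0 : (0 < 2^-1 :> R)%R by rewrite invr_gt0.
have [K HK] := summable_tail ha0 h0 aG.
have G0 : (0 < G)%R.
  have := aG 1%N; rewrite big_ord1 /a /= eqxx /=; apply: lt_le_trans; exact: ltr01.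
exists ((2 * G)^-1)%R; first by rewrite invr_gt0 mulr_gt0.
move=> n; have := last_visit x (K + n) x; rewrite eqxx adde0.
pose q i := fine (avoid c x 0 i x).
have qE i : avoid c x 0 i x = (q i)%:E.
  by rewrite fineK// ge0_fin_numE// (le_lt_trans (hold_le1 ke _ _ _ _))// ltry.
have q0 i : (0 <= q i)%R by rewrite fine_ge0.
have q1 i : (q i <= 1)%R by rewrite -lee_fin -qE; exact: hold_le1.
under eq_bigr => i _ do rewrite qE -(prE ke) -EFinM.
rewrite sumEFin qE lee_fin => -[].
rewrite -addnS big_split_ord/= => E.
have H1 : (\sum_(i < K) a i * q (K + n - i)%N <= G * q n)%R.
  apply: (@le_trans _ _ (\sum_(i < K) a i * q n)%R).
    apply: ler_sum => i _; rewrite ler_wpM2l// -lee_fin -!qE.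
    by apply: hold_le => //; rewrite addnC -addnBA ?leq_addr// ltnW.
  by rewrite -mulr_suml ler_wpM2r.
have H2 : (\sum_(i < n.+1) a (K + i)%N * q (K + n - (K + i))%N <= 2^-1)%R.
  apply: le_trans (HK K n.+1 (leqnn _)).
  by apply: ler_sum => i _; rewrite ler_piMr.
rewrite invfM -[leLHS]mulr1 -mulrA mulrC -mulrA ler_pdivrMl//.
move: E H1 H2; rewrite -/a; clear; lra.
Qed.

(** A loop at [y], extended by a path from [x] in [a] steps and one back in [b] steps, is a loop at
    [x]; hence the window for [x] is longer by [a + b]. *)
Lemma visits_transfer (G : R) x y : irreducible_walk k ->
  (forall n, visits c 0 n x x <= G%:E) ->
  exists G', forall n, visits c 0 n y y <= G'%:E.
Proof.
move=> irr H; have [a] := irr x y; have [b] := irr y x.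
rewrite !(@jump_nE _ _ (fun=> k) 0) => pb pa.
pose ra := fine (pr c 0 a x y); pose rb := fine (pr c 0 b y x).
have ra0 : (0 < ra)%R by rewrite -lte_fin prE.
have rb0 : (0 < rb)%R by rewrite -lte_fin prE.
exists ((ra * rb)^-1 * G)%R => n; pose P i u v := fine (pr c 0 i u v).
have P0 i u v : (0 <= P i u v)%R by rewrite fine_ge0.
rewrite visitsEFin lee_fin ler_pdivlMl ?mulr_gt0//.
have := H (a + b + n)%N; rewrite visitsEFin lee_fin; apply: le_trans.
rewrite big_split_ord/= -[leLHS]add0r; apply: lerD.
  by apply: sumr_ge0 => i _; exact: P0.
rewrite mulr_sumr.
apply: ler_sum => i _; rewrite -/(P _ _ _) -/(P _ _ _) -lee_fin.
have ck m1 m2 u v w : (P m1 u v * P m2 v w <= P (m1 + m2)%N u w)%R.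
  rewrite -lee_fin EFinM !prE// (pr_chapman_kolmogorov ke) add0n (pr_cst 0 m1 m2).
  apply: (@esum_ge_term _ _ (fun v => pr c 0 m1 u v * pr c m1 m2 v w)).
  by move=> t; rewrite mule_ge0.
rewrite lee_fin -mulrA -addnA (addnC b); apply: le_trans (ck a (i + b)%N x y x).
by apply: ler_wpM2l; [exact: ltW|rewrite mulrC; exact: ck].
Qed.

End homogeneous.

(** * Visits in the changing environment *)

Section changing_environment.
Context {R : realType} {V : countType}.
Variables (c : nat -> V -> V -> R) (ce : environment c).

Let p0 s n y z : 0 <= pr c s n y z := pr_ge0 ce s n y z.

(** With F the accumulated density, F(x)^2 <= r E(F) <= 2r F(x). Keeping [c'] apart from [c] lets
    every time shift be compared with the resistance of [c 0]. *)
Lemma occd_le_resistance (c' : nat -> V -> V -> R) x (r : R) n :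
  environment c' -> (forall u v, c 0%N u v <= c' 0%N u v)%R ->
  eff_res_infty (c 0%N) x = r%:E -> (occd c' x 0 n x <= 2 * r)%R.
Proof.
move=> ce' cc' cr; set F := occd c' x 0 n.
have c0n := env_network ce 0; have c0n' := env_network ce' 0.
have F0 := occd_ge0 ce' x 0 n; rewrite -/F in F0.
have r0 : (0 <= r)%R by rewrite -lee_fin -cr eff_res_infty_ge0.
have Fy : mform (wt (c 0%N)) F F < +oo.
  apply: le_lt_trans (mform_occd_fin ce' x n (leqnn 0)).
  by apply: le_esum => v _; rewrite lee_fin -!mulrA ler_wpM2r ?mulr_ge0// wt_le.
have := eff_res_infty_sqr c0n F0 Fy cr.
have := energy_occd ce' x 0 n; rewrite (mform_dens0 ce')// -EFinM -/F.
have := energy_le F c0n c0n' cc' => /le_trans/[apply].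
have := energy_ge0 F c0n; case: (energy _ _) => [e| |]//.
rewrite -EFinM !lee_fin => e0 e1 e2.
have := F0 x; rewrite le_eqVlt => /predU1P[<-|Fx0]; first by rewrite mulr_ge0.
rewrite -(ler_pM2r Fx0) -expr2 (le_trans e2)//.
by rewrite (mulrC 2%R) -mulrA ler_wpM2l.
Qed.

Lemma visits_shift s n y x :
  visits c s n y x = visits (fun t => c (s + t)%N) 0 n y x.
Proof. by apply: eq_bigr => i _; apply: eq_pr => j _; rewrite add0n. Qed.

Lemma visits_occd (c' : nat -> V -> V -> R) x n (w : R) : environment c' ->
  (forall t, wt (c' t) x <= w)%R ->
  visits c' 0 n x x <= (w * occd c' x 0 n x)%:E.
Proof.
move=> ce' cw; rewrite /visits /occd mulr_sumr -sumEFin; apply: lee_sum => i _.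
by rewrite -(densE ce') lee_fin ler_wpM2r// dens_ge0.
Qed.

Lemma visits_resistance x (r w : R) : eff_res_infty (c 0%N) x = r%:E ->
  (forall t, wt (c t) x <= w)%R ->
  forall s n y, visits c s n y x <= (2 * w * r)%:E.
Proof.
move=> cr cw; apply: visits_le => // s n; rewrite visits_shift.
have ces := environment_shift s ce.
apply: (le_trans (visits_occd n ces (fun t => cw (s + t)%N))).
rewrite lee_fin -mulrA (mulrCA 2%R) ler_wpM2l//.
  by rewrite (le_trans _ (cw 0%N))// wt_ge0//; exact: env_network.
by apply: occd_le_resistance => // u v; exact: env_le.
Qed.

Local Notation c0 := (fun _ : nat => c 0%N).
Let ce0 : environment c0 := environment_cst ce.
Let n0 : network (c 0%N) := env_network ce 0%N.

Lemma sum_dens_le x (G : R) : (forall n, visits c0 0 n x x <= G%:E) ->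
  forall n, (\sum_(i < n) dens c0 x i x <= G / wt (c 0%N) x)%R.
Proof.
move=> H n; rewrite ler_pdivlMr ?(env_wt_gt0 ce0 0%N)// -lee_fin.
apply: le_trans (H n); rewrite /visits mulr_suml -sumEFin; apply: lee_sum => i _.
by rewrite -(densE ce0) mulrC.
Qed.

Lemma resistance_finite x (G : R) : (forall n, visits c0 0 n x x <= G%:E) ->
  exists2 r : R, (0 <= r)%R & eff_res_infty (c 0%N) x = r%:E.
Proof.
move=> H; pose r := (G / wt (c 0%N) x)%R; have dr := sum_dens_le H; rewrite -/r in dr.
have r0 : (0 < r)%R.
  apply: lt_le_trans (dr 1%N); rewrite big_ord1 /dens /= eqxx/= div1r invr_gt0.
  exact: (env_wt_gt0 ce).
apply: ge0_real; first exact: eff_res_infty_ge0.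
apply: le_lt_trans (ltry (2 * r)%R); apply: eff_res_infty_le => //.
  by rewrite mulr_gt0.
move=> f f0 fy fx.
have l0 : (0 <= 2 * r)%R by rewrite mulr_ge0// ltW.
(* At time 0 the law is the unit mass at [x], so [l = 2 * r] gives 4r <= 4r^2 E(f) + 2r, that is 1
   <= 2r E(f). *)
have := @mform_dens_energy _ _ c0 ce0 x 0%N r (2 * r)%R f (fun=> erefl) f0 fy l0 dr.
rewrite (mform_dens0 ce0)// fx.
have := energy_ge0 f n0; case: (energy _ f) => [e| |]//.
  rewrite -!EFinM -EFinD !lee_fin => e0 He.
  by rewrite -(ler_pM2l r0); move: He; clear; nra.
by move=> _ _; rewrite gt0_muley ?leey// lte_fin mulr_gt0.
Qed.

Lemma late_visits_small x (r w G e : R) : eff_res_infty (c 0%N) x = r%:E ->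
  (forall t, wt (c t) x <= w)%R -> (forall n, visits c0 0 n x x <= G%:E) ->
  (0 < e)%R ->
  exists T, forall n,
    \esum_(y in [set: V]) (pr c0 0 T x y * visits c T n y x) <= e%:E.
Proof.
move=> cr cw H e0.
have w0 : (0 < w)%R by rewrite (lt_le_trans _ (cw 0%N))// (env_wt_gt0 ce).
have r0 : (0 <= r)%R by rewrite -lee_fin -cr eff_res_infty_ge0.
(* Chosen so that 8 r tau <= (e/w)^2, the bound on F(x)^2 reached below. *)
pose tau := ((e / w) ^+ 2 / (8 * r + 1))%R.
have r81 : (0 < 8 * r + 1)%R by rewrite ltr_wpDl// mulr_ge0.
have tau0 : (0 < tau)%R by rewrite divr_gt0// exprn_gt0// divr_gt0.
have [T HT] := summable_tail (fun i => dens_ge0 ce0 x i x) tau0 (sum_dens_le H).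
exists T => n.
have {}HT := fun k => HT T.*2 k (leq_trans (leq_addr T T) (eq_leq (addnn T))).
(* The environment is frozen at [c 0] before time [T]; it is still non-decreasing. *)
pose cT t := if (t < T)%N then c 0%N else c t.
have ceT : environment cT.
  split => [t|s t st u v|t v]; rewrite /cT.
  - by case: ifP => _; exact: env_network.
  - case: (ltnP s T) => sT; case: (ltnP t T) => tT => //; try exact: env_le.
    by have := leq_ltn_trans (leq_trans sT st) tT; rewrite ltnn.
  - by case: ifP => _; exact: (env_wt_gt0 ce).
have cTT : cT T = c T by rewrite /cT ltnn.
have prT v : pr cT 0 T x v = pr c0 0 T x v.
  by apply: eq_pr => i iT; rewrite /cT add0n iT.
set F := occd cT x T n; have F0 : nneg F := occd_ge0 ceT x T n.
have [K K0 FK] := occd_bounded ceT x T n.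
have [m m0 mE] := ge0_real (mform_ge0 (fun v => wt_ge0 v (env_network ceT T))
  (dens_ge0 ceT x T) F0) (le_lt_trans (mform_dens_le ceT x T K0 F0 FK) (ltry _)).
(* Weight times density is the law itself, which at time [T] is the same under [c0] and [cT]. *)
have mE0 : mform (wt (c 0%N)) (dens c0 x T) F = m%:E.
  rewrite -mE; apply: eq_esum => v _.
  by rewrite EFinM (densE ce0) EFinM (densE ceT) prT.
have Fy : mform (wt (c 0%N)) F F < +oo.
  have := mform_occd_fin ceT x n (leqnn T); apply: le_lt_trans.
  apply: le_esum => v _; rewrite lee_fin -!mulrA ler_wpM2r ?mulr_ge0//.
  by apply: wt_le => //; [exact: env_network|rewrite cTT => u z; exact: env_le].
have h0 : (0 <= 2^-1 :> R)%R by rewrite invr_ge0.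
have := @mform_dens_energy _ _ c0 ce0 x T tau 2^-1 F (fun=> erefl) F0 Fy h0 HT.
have := eff_res_infty_sqr n0 F0 Fy cr.
have := energy_occd ceT x T n; rewrite -/F mE mE0.
have le0T u v : (c 0%N u v <= cT T u v)%R by rewrite cTT; exact: env_le.
have := energy_le F n0 (env_network ceT T) le0T => /le_trans/[apply].
have := energy_ge0 F n0; case: (energy _ F) => [E| |]//.
rewrite -!EFinM -EFinD !lee_fin => E0 E1 E2 E3.
(* From E(F) <= 2m and, with [l] = 1/2, m <= E(F)/4 + 2 tau. *)
have m4 : (m <= 4 * tau)%R by move: E1 E3; clear; lra.
have F8 : (F x ^+ 2 <= (e / w) ^+ 2)%R.
  apply: (le_trans E2); apply: (@le_trans _ _ (r * (8 * tau))%R).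
    by rewrite ler_wpM2l//; move: E1 m4; clear; lra.
  rewrite /tau mulrA mulrCA; apply: ler_piMr; first exact: sqr_ge0.
  by rewrite ler_pdivrMr// mul1r mulrC lerDl.
have {}F8 : (F x <= e / w)%R by move: F8; rewrite ler_pXn2r// nnegrE ?F0// divr_ge0// ltW.
apply: (@le_trans _ _ (w * F x)%:E); last by rewrite lee_fin mulrC -ler_pdivlMr.
have -> : \esum_(y in [set: V]) (pr c0 0 T x y * visits c T n y x) =
    \sum_(i < n) pr cT 0 (T + i)%N x x.
  under eq_esum => y _.
    rewrite ge0_sume_distrr; last by move=> i _; exact: p0.
    over.
  rewrite esum_sum; last by move=> *; rewrite mule_ge0// pr_ge0.
  apply: eq_bigr => i _; rewrite (pr_chapman_kolmogorov ceT) add0n.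
  apply: eq_esum => y _; rewrite prT; congr (_ * _); apply: eq_pr => j _.
  by rewrite /cT ltnNge leq_addr.
rewrite mulr_sumr -sumEFin; apply: lee_sum => i _.
rewrite -(densE ceT) lee_fin ler_wpM2r ?dens_ge0//.
by rewrite /cT ltnNge leq_addr/=.
Qed.

End changing_environment.

(** * Escape probability *)

Section escape.
Context {R : realType} {V : countType}.
Variables (c : nat -> V -> V -> R) (ce : environment c) (x : V).

Local Notation c0 := (fun _ : nat => c 0%N).
Let ce0 : environment c0 := environment_cst ce.
Let j0 y z : 0 <= (jump (c 0%N) y z)%:E := environment_jump_ge0 0%N y z ce0.

(* Transition probability of the walk on [c 0] killed on entering [x] after time 0;
   the starting vertex may be [x]. *)
Fixpoint taboo n (y z : V) : \bar R :=
  if n is m.+1 then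
    \esum_(v in [set: V]) ((jump (c 0%N) y v)%:E * (if v == x then 0 else taboo m v z))
  else if y == z then 1 else 0.

Lemma taboo_ge0 n y z : 0 <= taboo n y z.
Proof.
elim: n y => [|n IH] y /=; first by case: ifP.
by apply: esum_ge0 => v _; rewrite mule_ge0//; case: ifP.
Qed.

Lemma taboo_le n y z : taboo n y z <= pr c0 0 n y z.
Proof.
elim: n y => [//|n IH] y /=; apply: le_esum => v _; rewrite lee_wpmul2l//.
by rewrite (pr_cst _ 1 0); case: ifP => // _; exact: (pr_ge0 ce0).
Qed.

Lemma taboo_sum n y : \esum_(z in [set: V]) taboo n y z = avoid c0 x 0 n y.
Proof.
elim: n y => [|n IH] y.
  rewrite (@esum_pred1 _ _ _ y) /=; first by rewrite eqxx.
    by move=> v; rewrite eq_sym => /negPf ->.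
  by rewrite eqxx.
rewrite avoidS /= esum_swap; last first.
  by move=> ? ?; rewrite mule_ge0//; case: ifP => // _; exact: taboo_ge0.
apply: eq_esum => v _; have [vx|vx] := eqVneq v x.
  by rewrite mule0 esum1// => z _; rewrite mule0.
rewrite esumZl ?(avoid_cst _ x 1 0) ?IH//; first by rewrite -lee_fin.
by move=> z; exact: taboo_ge0.
Qed.

(* Conductances only increase, so every edge of [c 0] can be crossed at any time. *)
Lemma avoid_taboo T y j v : (j <= T)%N -> 0 < taboo j v y ->
  (exists2 del : R, (0 < del)%R & forall n, del%:E <= avoid c x T n y) ->
  exists2 del : R, (0 < del)%R & forall n, del%:E <= avoid c x (T - j) n v.
Proof.
elim: j v => [|j IH] v jT.
  by rewrite /= subn0; case: eqVneq => [->//|_]; rewrite ltxx.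
move=> /= tab Hy.
have [z] : exists z, 0 < (jump (c 0%N) v z)%:E * (if z == x then 0 else taboo j z y).
  by apply: esum_gt0 tab => z; rewrite mule_ge0//; case: ifP => // _; exact: taboo_ge0.
have [|zx] := eqVneq z x; first by rewrite mule0 ltxx.
have [jz|jz] := ltP 0 (jump (c 0%N) v z)%:E; last first.
  have -> : (jump (c 0%N) v z)%:E = 0 by apply/eqP; rewrite eq_le jz j0.
  by rewrite mul0e ltxx.
rewrite pmule_rgt0// => /(IH _ (ltnW jT))/(_ Hy)[del del0 Hdel].
have czv : (0 < c 0%N v z)%R.
  move: jz; rewrite lte_fin /jump pmulr_lgt0// invr_gt0; exact: (env_wt_gt0 ce 0%N).
(* The edge of [c 0] is crossed at the actual time [T - j.+1], with the jump probability of that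
   time. *)
pose q := jump (c (T - j.+1)%N) v z.
have q0 : (0 < q)%R.
  rewrite divr_gt0//; last exact: (env_wt_gt0 ce (T - j.+1)%N).
  by apply: (lt_le_trans czv); exact: env_le.
have q1 : (q <= 1)%R.
  rewrite -lee_fin -(environment_jump_sum (T - j.+1)%N v ce).
  by apply: (@esum_ge_term _ _ (fun z => (jump (c (T - j.+1)%N) v z)%:E)) => w;
    exact: environment_jump_ge0.
exists (q * del)%R; first by rewrite mulr_gt0.
move=> n; apply: le_trans (hold_leS ce (fun _ v => v != x) _ _ _).
rewrite -/(avoid _ _ _ _ _) avoidS.
have -> : (T - j.+1).+1 = (T - j)%N by rewrite subnSK.
apply: (@le_trans _ _ (q%:E * (if z == x then 0 else avoid c x (T - j) n z))).
  by rewrite (negPf zx) EFinM lee_wpmul2l// lee_fin ltW.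
apply: (@esum_ge_term _ _ (fun z => (jump (c (T - j.+1)%N) v z)%:E *
  (if z == x then 0 else avoid c x (T - j) n z))) => w.
rewrite mule_ge0//; first exact: environment_jump_ge0.
by case: ifP => // _; exact: hold_ge0.
Qed.

Lemma escape_pos (r w G : R) : eff_res_infty (c 0%N) x = r%:E ->
  (forall t, wt (c t) x <= w)%R -> (forall n, visits c0 0 n x x <= G%:E) ->
  exists2 del : R, (0 < del)%R & forall n, del%:E <= avoid c x 0 n x.
Proof.
move=> cr cw H; have [rho rho0 Hrho] := escape_of_visits ce0 H.
have rho2 : (0 < rho / 2)%R by rewrite divr_gt0.
have [T HT] := late_visits_small ce cr cw H rho2.
(* Expected number of visits to [x] from time [T] on, for the changing walk at [y] at time [T]. *)
pose O y := \esum_(i in [set: nat]) pr c T i y x.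
have O0 y : 0 <= O y by apply: esum_ge0 => i _; exact: pr_ge0.
have TO : \esum_(y in [set: V]) (taboo T x y * O y) <= (rho / 2)%:E.
  apply: (@le_trans _ _ (\esum_(y in [set: V]) (pr c0 0 T x y * O y))).
    by apply: le_esum => y _; rewrite lee_wpmul2r// taboo_le.
  under eq_esum => y _.
    rewrite -(prE ce0) -esumZl; last 2 first.
    - by rewrite fine_ge0// pr_ge0.
    - by move=> i; exact: pr_ge0.
    over.
  rewrite esum_swap; last first.
    by move=> y i; rewrite (prE ce0) mule_ge0// ?(pr_ge0 ce0)// (pr_ge0 ce).
  rewrite -nneseries_esumT; last first.
    move=> i; apply: esum_ge0 => y _.
    by rewrite (prE ce0) mule_ge0// ?(pr_ge0 ce0)// (pr_ge0 ce).
  apply: lime_le.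
    apply: is_cvg_nneseries => i _ _; apply: esum_ge0 => y _.
    by rewrite (prE ce0) mule_ge0// ?(pr_ge0 ce0)// (pr_ge0 ce).
  apply: nearW => n; rewrite big_mkord; apply: le_trans (HT n).
  rewrite -esum_sum; last first.
    by move=> y i _ _; rewrite (prE ce0) mule_ge0// ?(pr_ge0 ce0)// (pr_ge0 ce).
  apply: le_esum => y _; rewrite /visits ge0_sume_distrr; last first.
    by move=> i _; exact: pr_ge0.
  by apply: lee_sum => i _; rewrite (prE ce0).
(* Otherwise [O y] is at least 1 wherever the killed walk can be, and [rho] <= avoidance up to [T]
   <= [rho / 2]. *)
have [y [ty Oy]] : exists y, 0 < taboo T x y /\ O y < 1.
  apply: contrapT => /forallNP no.
  have : rho%:E <= (rho / 2)%:E; last by rewrite lee_fin leNgt ltr_pdivrMr ?ltr_pMr ?ltr1n.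
  apply: le_trans TO; apply: (le_trans (Hrho T)); rewrite -taboo_sum.
  apply: le_esum => y _; have := taboo_ge0 T x y; rewrite le_eqVlt => /predU1P[<-|ty].
    by rewrite mul0e.
  rewrite -[leLHS]mule1 lee_wpmul2l ?taboo_ge0// leNgt.
  by apply/negP => Oy; exact: (no y).
have yx : y != x.
  apply: contraTneq Oy => ->; rewrite -leNgt.
  have p0 i : 0 <= pr c T i x x by exact: pr_ge0.
  by have := @esum_ge_term R nat (fun i => pr c T i x x) 0%N p0; rewrite /= eqxx.
have [q q0 oE] := ge0_real (O0 y) (lt_trans Oy (ltry _)).
have := @avoid_taboo T y T x (leqnn _) ty; rewrite subnn; apply.
(* By Markov's inequality, [x] is never hit from [y] with probability at least 1 - [O y]. *)
exists (1 - q)%R; first by move: Oy; rewrite oE lte_fin subr_gt0.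
move=> n; have := avoid_visits ce T n yx.
rewrite EFinB leeBlDr// => /le_trans; apply; rewrite leeD2l// -oE.
rewrite /O -nneseries_esumT; last by move=> i; exact: pr_ge0.
rewrite /visits -(big_mkord xpredT (fun i => pr c T i y x)).
by apply: nneseries_lim_ge => i _ _; exact: pr_ge0.
Qed.

End escape.

(** * From processes to kernels *)

Section process.
Context {R : realType} {V : countType} {d : measure_display}
  {Omega : measurableType d}.
Variables (P : probability Omega R) (X : nat -> Omega -> V).
Hypothesis mX : forall t (A : set V), measurable (X t @^-1` A).

Definition stays (W : nat -> V -> bool) s n : set Omega :=
  [set w | forall i, (s <= i <= n)%N -> W i (X i w)].

Definition path_event (h : nat -> V) n : set Omega :=
  [set w | forall i, (i <= n)%N -> X i w = h i].

Lemma stays_measurable W s n : measurable (stays W s n).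
Proof.
have -> : stays W s n = \bigcap_(i in [set i | (s <= i <= n)%N]) (X i @^-1` [set v | W i v]).
  by apply/seteqP; split.
by apply: bigcap_measurableType.
Qed.

Lemma path_event_measurable h n : measurable (path_event h n).
Proof.
have -> : path_event h n = \bigcap_(i in [set i | (i <= n)%N]) (X i @^-1` [set h i]).
  by apply/seteqP; split.
by apply: bigcap_measurableType.
Qed.

(** Codes of vertices turn the partition into a disjoint union over [nat]; numbers coding no vertex
    give empty events. *)
Lemma probability_partition A t : measurable A ->
  P A = \esum_(v in [set: V]) P (A `&` X t @^-1` [set v]).
Proof.
move=> mA; pose F n := A `&` X t @^-1` [set v | choice.pickle v = n].
have -> : P A = P (\bigcup_n F n).
  by congr (P _); apply/seteqP; split=> [w Aw|w [n _ []]//]; exists (choice.pickle (X t w)).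
rewrite measure_bigcup//; last 2 first.
- by move=> i _; exact: measurableI.
- by move=> i j _ _ [w [[_ /= <-] [_ /= <-]]].
rewrite nneseries_esum// set_mem_set.
have -> : \esum_(i in [set: nat]) P (F i) = \esum_(i in range (@choice.pickle V)) P (F i).
  rewrite [RHS]esum_mkcond; apply: eq_esum => i _; case: ifPn => //.
  rewrite notin_setE => ni; rewrite (_ : F i = set0) ?measure0//.
  by apply/seteqP; split=> [w [_ /= wi]|//]; apply: ni; exists (X t w).
rewrite esum_image; last by move=> u v _ _ /(pcan_inj choice.pickleK).
apply: eq_esum => v _; congr (P _); apply/seteqP; split=> w [Aw /=].
  by move=> /(pcan_inj choice.pickleK) wv; split.
by move=> wv; split => //=; rewrite wv.
Qed.

Variables (c : nat -> V -> V -> R) (o : V).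
Hypothesis start : P (X 0%N @^-1` [set o]) = 1.
Hypothesis step : forall t (h : nat -> V),
  P (path_event h t.+1) = P (path_event h t) * (jump (c t) (h t) (h t.+1))%:E.

Lemma start_as A : measurable A -> P A = P (A `&` X 0%N @^-1` [set o]).
Proof.
move=> mA; set S := X 0%N @^-1` [set o].
have mS : measurable S := mX 0%N [set o].
have S0 : P (~` S) = 0 by rewrite probability_setC// start subee.
rewrite (measureDI P mA mS) -[RHS]add0e; congr (_ + _).
apply/eqP; rewrite eq_le measure_ge0 andbT -S0; apply: le_measure; rewrite ?inE.
- exact: measurableD.
- exact: measurableC.
- by move=> w [].
Qed.

(** The start has mass 1 and splits over the next state, so some jump from [o] is positive; this is
    what excludes total conductance 0 at [o]. *)
Lemma first_jump_pos : exists z, (0 < jump (c 0%N) o z)%R.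
Proof.
have : 0 < P (X 0%N @^-1` [set o]) by rewrite start.
have P0 v : 0 <= P (X 0%N @^-1` [set o] `&` X 1%N @^-1` [set v]) by [].
rewrite (probability_partition 1%N)// => /(esum_gt0 P0)[z].
pose h i := if i is 0%N then o else z.
have -> : X 0%N @^-1` [set o] `&` X 1%N @^-1` [set z] = path_event h 1%N.
  apply/seteqP; split=> [w [/= X0 X1] [|[|]]//|w H].
  by split; [exact: (H 0%N)|exact: (H 1%N)].
rewrite (step 0%N h) (_ : path_event h 0%N = X 0%N @^-1` [set o]); last first.
  by apply/seteqP; split=> [w H|w X0 [|]//]; exact: (H 0%N).
by rewrite start mul1e lte_fin => jz; exists z.
Qed.

Hypothesis ce : environment c.

(** Markov property: the event is split by the state at time [s.+1], by which the path [h] is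
    extended to [h']. *)
Lemma path_event_stays W n s h :
  P (path_event h s `&` stays W s.+1 (s + n)) = P (path_event h s) * hold c W s n (h s).
Proof.
elim: n s h => [|n IH] s h.
  rewrite mule1; congr (P _); apply/seteqP; split=> [w []//|w hw]; split => // i.
  by rewrite addn0 => /andP[/leq_trans H /H]; rewrite ltnn.
rewrite (probability_partition s.+1); last first.
  by apply: measurableI; [exact: path_event_measurable|exact: stays_measurable].
rewrite holdS.
have -> : P (path_event h s) = (fine (P (path_event h s)))%:E.
  by rewrite fineK// fin_num_measure//; exact: path_event_measurable.
rewrite -esumZl ?fine_ge0//; last first.
  move=> z; rewrite mule_ge0 ?environment_jump_ge0//.
  by case: ifP => // _; exact: hold_ge0.
apply: eq_esum => z _; rewrite fineK; last first.
  by rewrite fin_num_measure//; exact: path_event_measurable.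
pose h' i := if i == s.+1 then z else h i.
have h's : path_event h' s = path_event h s.
  by apply/seteqP; split=> w H i is_; rewrite H// /h' ltn_eqF.
have hs : h' s = h s by rewrite /h' ltn_eqF.
have hs1 : h' s.+1 = z by rewrite /h' eqxx.
have h'S : path_event h' s.+1 = path_event h s `&` X s.+1 @^-1` [set z].
  apply/seteqP; split=> [w H|w [H Xz] i].
    split; last by have := H s.+1 (leqnn _); rewrite hs1.
    by rewrite -h's => i is_; apply: H; exact: leqW.
  by rewrite leq_eqVlt ltnS => /predU1P[->|is_]; rewrite ?hs1// H// /h' ltn_eqF.
have [Wz|Wz] := boolP (W s.+1 z); last first.
  rewrite !mule0 (_ : _ `&` _ = set0) ?measure0//; apply/seteqP; split => // w.
  move=> [[_ H] /= Xz]; have := H s.+1; rewrite leqnn addnS leq_addr Xz => /(_ isT).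
  exact/negP.
have := IH s.+1 h'; rewrite step h's hs hs1 -muleA => <-; congr (P _).
rewrite h'S; apply/seteqP; split=> w.
  move=> [[H1 H2] H3]; split=> [|i /andP[i1 i2]]; first by split.
  apply: H2.
  by rewrite (ltnW i1) addnS -addSn i2.
move=> [[H1 H3] H2]; split => //; split => // i /andP[].
rewrite leq_eqVlt => /predU1P[<- _|i1 i2]; first by rewrite H3.
by apply: H2; rewrite i1 addSn -addnS.
Qed.

Lemma stays_start W n :
  P (stays W 0 n) = if W 0%N o then hold c W 0 n o else 0.
Proof.
rewrite start_as; last exact: stays_measurable.
have -> : stays W 0 n `&` X 0%N @^-1` [set o] =
    if W 0%N o then path_event (cst o) 0 `&` stays W 1 (0 + n) else set0.
  apply/seteqP; split=> w.
    move=> [H /= X0]; have := H 0%N isT; rewrite X0 => ->; split.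
      by move=> i; rewrite leqn0 => /eqP ->.
    by move=> i /andP[_ ni]; exact: H.
  case: ifP => // W0 [H1 H2]; have X0 := H1 0%N isT; split => // -[|i] /andP[_ ni].
    by rewrite X0.
  exact: H2.
case: ifP => _; last by rewrite measure0.
rewrite path_event_stays (_ : path_event _ _ = X 0%N @^-1` [set o]) ?start ?mul1e//.
by apply/seteqP; split=> [w H|w X0 [|]//]; exact: (H 0%N).
Qed.

(** A visit at time [t] followed by avoidance, as one time-dependent constraint to which [stays] and
    [hold] apply. *)
Definition visit_then_avoid (x : V) t i v : bool :=
  if (i < t)%N then true else if i == t then v == x else v != x.

Lemma hold_visit_then_avoid x s j n y t : t = (s + j)%N ->
  (if visit_then_avoid x t s y then hold c (visit_then_avoid x t) s (j + n) y else 0) =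
  pr c s j y x * avoid c x t n x.
Proof.
elim: j s y => [|j IH] s y ts.
  rewrite {1}/visit_then_avoid ts addn0 ltnn eqxx /=; case: eqP => [->|_].
    rewrite mul1e; apply: eq_hold => // i z _.
    by rewrite /visit_then_avoid ltnNge leqW ?leq_addr//= gtn_eqF// ltnS leq_addr.
  by rewrite mul0e.
have st : (s < t)%N by rewrite ts -addSnnS leq_addr.
rewrite {1}/visit_then_avoid st addSn holdS.
have -> : avoid c x t n x = (fine (avoid c x t n x))%:E.
  by rewrite fineK// ge0_fin_numE ?hold_ge0// (le_lt_trans (hold_le1 ce _ _ _ _))// ltry.
rewrite muleC /= -esumZl; last 2 first.
- by rewrite fine_ge0// hold_ge0.
- by move=> z; rewrite mule_ge0 ?environment_jump_ge0// pr_ge0.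
apply: eq_esum => z _; rewrite IH ?ts ?addSnnS// fineK; last first.
  by rewrite ge0_fin_numE ?hold_ge0// (le_lt_trans (hold_le1 ce _ _ _ _))// ltry.
by rewrite muleA muleC.
Qed.

Lemma probability_visit_then_avoid x t n :
  P (X t @^-1` [set x] `&` [set w | forall i, (t < i <= t + n)%N -> X i w != x]) =
  pr c 0 t o x * avoid c x t n x.
Proof.
rewrite -(hold_visit_then_avoid x n o (esym (add0n t))) -stays_start; congr (P _).
rewrite /visit_then_avoid; apply/seteqP; split=> w.
  move=> [/= Xt H] i /= it; case: ltngtP => // [ti|->]; last by rewrite Xt.
  by apply: H; rewrite ti.
move=> H; split.
  have /= := H t; rewrite leq_addr ltnn eqxx => /(_ isT)/eqP; exact.
move=> i /andP[ti itn]; have /= := H i itn.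
by rewrite ltnNge (ltnW ti)/= gtn_eqF.
Qed.

Lemma probability_visit x t : P (X t @^-1` [set x]) = pr c 0 t o x.
Proof.
rewrite -[RHS]mule1 -(probability_visit_then_avoid x t 0); congr (P _).
apply/seteqP; split=> [w Xt|w []//]; split => // i.
by rewrite addn0 => /andP[/leq_trans H /H]; rewrite ltnn.
Qed.

End process.

(** * Almost sure finiteness of visits and the last visit *)

Section visits_as.
Context {R : realType} {V : countType} {d : measure_display}
  {Omega : measurableType d}.
Variables (P : probability Omega R) (X : nat -> Omega -> V).
Hypothesis mX : forall t (A : set V), measurable (X t @^-1` A).

Lemma expected_visitsE x :
  expected_visits P X x = \sum_(0 <= t <oo) P (X t @^-1` [set x]).
Proof.
have dE t w : \d_t [set t | X t w = x] = (\1_(X t @^-1` [set x]) w : R)%:E.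
  by rewrite diracE indicE; congr (_%:R%:E); apply/idP/idP; rewrite !inE.
rewrite /expected_visits.
under eq_integral => w _.
  rewrite counting_dirac; under eq_eseriesr => t _ do rewrite dE.
  over.
rewrite integral_nneseries//.
- by apply: eq_eseriesr => t _; rewrite integral_indic// setIT.
- move=> t; apply/measurable_realfun.measurable_EFinP.
  exact: measurable_realfun.measurable_indic.
Qed.

(** Borel-Cantelli at each vertex, then a countable intersection over the codes of vertices. *)
Lemma transient_of_summable :
  (forall x, \sum_(0 <= t <oo) P (X t @^-1` [set x]) < +oo) -> transient P X.
Proof.
move=> H; rewrite /transient.
have fin v : {ae P, forall w, finite_set [set t | X t w = v]}.
  exists (lim_sup_set (fun t => X t @^-1` [set v])); split.
  - by apply: bigcapT_measurable => n; apply: bigcup_measurable.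
  - by apply: lim_sup_set_cvg0 => [k|]; [exact: mX|exact: H].
  - move=> w /= nfin n _; apply: contrapT => none; apply: nfin.
    apply: sub_finite_set (finite_II n) => t /= Xt.
    by rewrite ltnNge; apply/negP => nt; apply: none; exists t.
have {}fin n : {ae P, forall w, if choice.unpickle n is Some v
    then finite_set [set t | X t w = (v : V)] else True}.
  by case: choice.unpickle => [v|]; [exact: fin|exact: aeW].
apply: filterS (ae_foralln fin) => w Hw v; have := Hw (choice.pickle v).
by rewrite choice.pickleK.
Qed.

(** A transient walk started at [o] almost surely has a last visit to [o]; the possible times are
    countable, so one of them has positive probability. *)
Lemma last_visit_of_transient o : P (X 0%N @^-1` [set o]) = 1 -> transient P X ->
  exists t, 0 < P (\bigcap_n
    (X t @^-1` [set o] `&` [set w | forall i, (t < i <= t + n)%N -> X i w != o])).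
Proof.
move=> start tr; pose L t := \bigcap_n
  (X t @^-1` [set o] `&` [set w | forall i, (t < i <= t + n)%N -> X i w != o]).
have mL t : measurable (L t).
  apply: bigcapT_measurable => n; apply: measurableI => //.
  exact: (stays_measurable mX (fun _ v => v != o) _ _).
apply: contrapT => /forallNP no.
have L0 t : P (L t) = 0.
  by apply/eqP; rewrite eq_le measure_ge0 andbT leNgt; apply/negP; exact: no.
have : P.-negligible (\bigcup_t L t).
  by apply: negligible_bigcup => t; apply/negligibleP; [exact: mL|exact: L0].
move=> /negligibleU/(_ tr); set B := _ `|` _ => nB.
have SB : X 0%N @^-1` [set o] `<=` B.
  move=> w X0; apply: contrapT => /not_orP[nL /= /contrapT fin].
  have finw := fin o; pose N := (\max_(i <- fset_set [set t | X t w = o]) i)%N.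
  have HN i : X i w == o -> (i <= N)%N.
    by move=> /eqP Xi; apply: leq_bigmax_seq => //; rewrite in_fset_set// inE.
  have ex0 : exists i, X i w == o by exists 0%N; apply/eqP.
  have [t /eqP Xt tmax] := ex_maxnP ex0 HN.
  apply: nL; exists t => // n _; split => // i /andP[ti _].
  by apply/negP => /tmax; rewrite leqNgt ti.
have : P (X 0%N @^-1` [set o]) = 0.
  by apply/negligibleP; [exact: mX|exact: negligibleS nB].
by rewrite start => /eqP; rewrite onee_eq0.
Qed.

End visits_as.

(** * The escape event of the process *)

Section walk.
Context {R : realType} {V : countType} {d : measure_display}
  {Omega : measurableType d}.
Variables (P : probability Omega R) (X : nat -> Omega -> V).
Variables (c : nat -> V -> V -> R) (o : V).
Hypothesis XW : random_walk c o P X.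

Let mX := walk_measurable XW.
Let start := walk_start XW.
Let step := walk_step XW.

Lemma walk_jump_pos : exists z, (0 < jump (c 0%N) o z)%R.
Proof. exact: (first_jump_pos mX start step). Qed.

Hypothesis ce : environment c.

Lemma walk_visit x t : P (X t @^-1` [set x]) = pr c 0 t o x.
Proof. exact: (probability_visit mX start step ce). Qed.

(** Escape is the decreasing limit of avoidance over finitely many steps; [W] leaves time 0 free. *)
Lemma walk_escape (del : R) : (0 < del)%R ->
  (forall n, del%:E <= avoid c o 0 n o) ->
  0 < P [set w | forall t, (0 < t)%N -> X t w <> o].
Proof.
move=> del0 H; pose W := fun (i : nat) (v : V) => (i == 0%N) || (v != o).
have -> : [set w | forall t, (0 < t)%N -> X t w <> o] = \bigcap_n stays X W 0 n.
  apply/seteqP; split=> w Hw; first by move=> n _ [|i]//= _; apply/eqP; exact: Hw.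
  by move=> [//|t] _; apply/eqP; have := Hw t.+1 I t.+1; rewrite /W/= leqnn; apply.
apply: (@lt_le_trans _ _ del%:E) => //.
have mS n : measurable (stays X W 0 n) := stays_measurable mX W 0 n.
have /cvg_lim <- // : P (stays X W 0 n) @[n --> \oo] --> P (\bigcap_n stays X W 0 n).
  apply: nonincreasing_cvg_mu => //.
  - by rewrite (le_lt_trans (probability_le1 _ _))// ltry.
  - exact: bigcapT_measurable.
  - move=> m n mn; apply/subsetPset => w Hw i /andP[_ im]; apply: Hw.
    exact: leq_trans im mn.
apply: lime_ge.
  apply: ereal_nonincreasing_is_cvgn => m n mn; apply: le_measure; rewrite ?inE//.
  by move=> w Hw i /andP[_ im]; apply: Hw; exact: leq_trans im mn.
apply: nearW => n; rewrite (stays_start mX start step ce)/=.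
by rewrite (le_trans (H n))// /avoid (@eq_hold _ _ c c _ W 0 0).
Qed.

End walk.

(** Some time [t] is the last visit to [o] with positive probability. That probability is at most
    p_t(o,o) times the avoidance over [n] steps, for every [n], so it can serve as [rho]. *)
Lemma transient_escape {R : realType} {V : countType} {d : measure_display}
    {Omega : measurableType d} (P : probability Omega R) (X : nat -> Omega -> V)
    (k : V -> V -> R) (o : V) (ke : environment (fun=> k)) :
  random_walk (fun=> k) o P X -> transient P X ->
  exists2 rho : R, (0 < rho)%R & forall n, rho%:E <= avoid (fun=> k) o 0 n o.
Proof.
move=> [mX start step] tr; have [t] := last_visit_of_transient mX start tr.
set L := \bigcap_n _ => L0; exists (fine (P L)).
  by apply: fine_gt0; rewrite L0 ltey_eq fin_num_measure//; apply: bigcapT_measurable => n;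
    apply: measurableI => //; exact: (stays_measurable mX (fun _ v => v != o) _ _).
move=> n; rewrite fineK; last first.
  rewrite fin_num_measure//; apply: bigcapT_measurable => m.
  by apply: measurableI => //; exact: (stays_measurable mX (fun _ v => v != o) _ _).
have := probability_visit_then_avoid mX start step ke o t n => E.
apply: (@le_trans _ _ (pr (fun=> k) 0 t o o * avoid (fun=> k) o t n o)).
  rewrite -E; apply: le_measure; rewrite ?inE.
  - apply: bigcapT_measurable => m.
    by apply: measurableI => //; exact: (stays_measurable mX (fun _ v => v != o) _ _).
  - by apply: measurableI => //; exact: (stays_measurable mX (fun _ v => v != o) _ _).
  - by move=> w; exact.
rewrite (avoid_cst k o t 0) -[leRHS]mul1e lee_wpmul2r ?pr_le1//.
exact: hold_ge0.
Qed.

(** * The theorem *)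

Section setup.
Context {R : realType} {V : countType}.

(** Irreducibility gives a positive jump out of every vertex other than [o]; at [o] it is supplied
    by the existence of the walk. *)
Lemma total_cond_gt0 (k : V -> V -> R) (o : V) : conductances k ->
  (forall v, total_cond k v < +oo) -> irreducible_walk k ->
  (exists z, (0 < jump k o z)%R) -> forall v, (0 < wt k v)%R.
Proof.
move=> kc ky irr jo v; have nk : network k by split.
have wt_pos u : (exists z, (0 < jump k u z)%R) -> (0 < wt k u)%R.
  move=> [z jz]; rewrite lt_neqAle wt_ge0// andbT; apply/eqP => wu.
  by move: jz; rewrite /jump -/(wt k u) -wu invr0 mulr0 ltxx.
have [->|vo] := eqVneq v o; first exact: wt_pos.
have [[|n]] := irr v o; first by rewrite /= (negPf vo) ltxx.
have j0 y z : 0 <= (jump k y z)%:E by rewrite lee_fin jump_ge0.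
have jn0 m y z : 0 <= jump_n k m y z.
  elim: m y => [|m IH] y /=; first by case: ifP.
  by apply: esum_ge0 => w _; rewrite mule_ge0.
move=> /= /esum_gt0[w|w]; first by rewrite mule_ge0.
move=> jw; apply: wt_pos; exists w; rewrite -lte_fin lt_neqAle j0 andbT.
by apply/eqP => jE; move: jw; rewrite -jE mul0e ltxx.
Qed.

End setup.

Theorem theorem1p8 (R : realType) (V : countType)
  (c : nat -> V -> V -> R) (cinf : V -> V -> R)
  (c_cond : forall t, conductances (c t))
  (c_mono : forall u v, nondecreasing_seq (fun t => c t u v))
  (c_lim : forall u v, c t u v @[t --> \oo] --> cinf u v)
  (pi_inf_fin : forall v, total_cond cinf v < +oo)
  (* (Y_t) : the random walk on G_0 = (V, c_0) *)
  (d0 : measure_display) (Omega0 : measurableType d0)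
  (P0 : probability Omega0 R) (Y : nat -> Omega0 -> V) (o0 : V)
  (Y_walk : random_walk (fun=> c 0%N) o0 P0 Y)
  (G0_irr : irreducible_walk (c 0%N))
  (G0_transient : transient P0 Y)
  (* (X_t) : the random walk in the changing environment *)
  (d : measure_display) (Omega : measurableType d)
  (P : probability Omega R) (X : nat -> Omega -> V) (o : V)
  (X_walk : random_walk c o P X) :
  [/\ transient P X,
      forall x, expected_visits P X x < +oo,
      forall x, \sum_(0 <= t <oo) P (X t @^-1` [set x])
                <= 2%:E * total_cond cinf x * eff_res_infty (c 0%N) x
    & forall (x : V) (d' : measure_display) (Omega' : measurableType d')
        (P' : probability Omega' R) (X' : nat -> Omega' -> V),
        random_walk c x P' X' ->
        0 < P' [set w | forall t, (0 < t)%N -> X' t w <> x]].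
Proof.
have c_le_inf t u v : (c t u v <= cinf u v)%R.
  have := nondecreasing_cvgn_le (c_mono u v).
  by move=> /(_ (cvgP _ (c_lim u v)) t); rewrite (cvg_lim _ (c_lim u v)).
have c_fin t v : total_cond (c t) v < +oo.
  by apply: le_lt_trans (pi_inf_fin v); apply: le_esum => z _; rewrite lee_fin.
have cn t : network (c t) by split.
have cle s t : (s <= t)%N -> forall u v, (c s u v <= c t u v)%R.
  by move=> st u v; exact: c_mono.
have ce : environment c.
  split => // t v; apply: (@lt_le_trans _ _ (wt (c 0%N) v)).
    apply: (total_cond_gt0 (o := o0)) => //; exact: (walk_jump_pos Y_walk).
  by apply: wt_le => //; exact: cle.
have ce0 := environment_cst ce.
(* Transience gives escape at [o0], escape gives bounded visits there, and irreducibility carries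
   the bound to every vertex. *)
have [rho rho0 Hrho] := transient_escape ce0 Y_walk G0_transient.
have Ho0 := visits_of_escape ce0 rho0 Hrho.
have Hx x := visits_transfer ce0 x G0_irr Ho0.
have winf x : exists2 w : R, total_cond cinf x = w%:E & forall t, (wt (c t) x <= w)%R.
  have [|w w0 wE] := ge0_real _ (pi_inf_fin x).
    apply: esum_ge0 => z _; rewrite lee_fin (le_trans _ (c_le_inf 0%N _ _))//.
    by case: (c_cond 0%N).
  exists w => // t; rewrite -lee_fin wtE// -wE.
  by apply: le_esum => z _; rewrite lee_fin.
have bound x : \sum_(0 <= t <oo) P (X t @^-1` [set x])
    <= 2%:E * total_cond cinf x * eff_res_infty (c 0%N) x.
  have [G HG] := Hx x; have [r r0 rE] := resistance_finite ce HG.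
  have [w wE cw] := winf x.
  rewrite rE wE -!EFinM; apply: lime_le.
    by apply: is_cvg_nneseries => t _ _; exact: measure_ge0.
  apply: nearW => n; rewrite big_mkord.
  apply: le_trans (visits_resistance ce rE cw 0%N n o).
  by apply: lee_sum => i _; rewrite (walk_visit X_walk ce).
have fin x : \sum_(0 <= t <oo) P (X t @^-1` [set x]) < +oo.
  have [G HG] := Hx x; have [r r0 rE] := resistance_finite ce HG.
  have [w wE cw] := winf x.
  by apply: le_lt_trans (bound x) _; rewrite rE wE -!EFinM ltry.
split.
- exact: (transient_of_summable (walk_measurable X_walk)).
- by move=> x; rewrite (expected_visitsE _ (walk_measurable X_walk)).
- exact: bound.
- move=> x d' Omega' P' X' X'_walk.
  have [G HG] := Hx x; have [r r0 rE] := resistance_finite ce HG.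
  have [w wE cw] := winf x.
  (* [del] depends on the environment and [x] only, so it serves every walk started at [x]. *)
  have [del del0 Hdel] := escape_pos ce rE cw HG.
  exact: (walk_escape X'_walk ce del0 Hdel).
Qed.
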